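(* Consider a $K$-armed stochastic bandit with reward distributions $P_1,\dots,P_K$, where $P_j$ has mean $\mu_j$ and finite variance $\sigma_j^2<\infty$, and suppose there is an arm $j^*\in[K]$ with $\mu_{j^*}>\max_{j\ne j^*}\mu_j$. Let $\Theta$ be an arbitrary subset of $\mathbb{R}^K$ that contains the true mean vector $\mu=(\mu_1,\dots,\mu_K)$. Run MINTS with the uniform prior over $[K]$, the Gaussian likelihood with $\sigma=1$, and parameter space $\Theta$. Then $$\limsup_{T\to\infty}\frac{\mathrm{Regret}(T)}{\log T}\le\sum_{j\ne j^*}\frac{2}{\Delta_j}\qquad\text{almost surely.}$$
   Context: Notation: $[K]=\{1,\dots,K\}$. Each arm $j\in[K]$ has a reward distribution $P_j$ on $\mathbb{R}$ with mean $\mu_j$; $\Delta_j=\max_{k\in[K]}\mu_k-\mu_j$ is its suboptimality gap. At each period $t=1,2,\dots$ the agent picks an arm $x_t\in[K]$ and receives feedback $\phi_t$, which conditionally on the past data and $x_t$ is drawn from $P_{x_t}$. The dataset is $\mathcal{D}_0=\varnothing$, $\mathcal{D}_t=\mathcal{D}_{t-1}\cup\{(x_t,\phi_t)\}$. The regret is $\mathrm{Regret}(T)=\sum_{t=1}^T\Delta_{x_t}$. MINTS (minimalist Thompson sampling) with prior $Q_0$ on $[K]$, Gaussian likelihood with parameter $\sigma>0$, and parameter space $\Theta\subseteq\mathbb{R}^K$: the likelihood is $$L(\theta;\mathcal{D}_t)=\prod_{i=1}^t\frac{1}{\sqrt{2\pi}\,\sigma}\exp\left(-\frac{(\theta_{x_i}-\phi_i)^2}{2\sigma^2}\right),\quad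 \theta\in\Theta.$$ For $j\in[K]$ let $\Theta_j=\{v\in\Theta: v_j\ge v_k\ \forall k\in[K]\}$ and define the profile likelihood $\bar L(j;\mathcal{D}_t)=\sup_{v\in\Theta_j}L(v;\mathcal{D}_t)$ (with value $0$ if $\Theta_j=\varnothing$). The generalized posterior for $t\ge1$ is $Q_t(j)=\bar L(j;\mathcal{D}_t)Q_0(j)\big/\sum_{k=1}^K\bar L(k;\mathcal{D}_t)Q_0(k)$. At each period $t$, conditionally on $\mathcal{D}_{t-1}$, the arm $x_t$ is sampled from $Q_{t-1}$. The Gaussian model only defines the algorithm; the true rewards need not be Gaussian. *)

(* Defs.v *)
From HB Require Import structures.
From mathcomp Require Import all_boot all_order all_algebra.
From mathcomp Require Import all_classical all_reals all_analysis.
From mathcomp Require Import measurable_realfun.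
Set Implicit Arguments.
Unset Strict Implicit.
Unset Printing Implicit Defensive.
Import Order.TTheory GRing.Theory Num.Theory.
Import numFieldNormedType.Exports.
Local Open Scope classical_set_scope.
Local Open Scope ring_scope.

(* Arms are the elements of 'I_K.  Time is counted from 0: the arm and the
   feedback of period t+1 are X t and Y t, so that the data available before
   this period are the pairs (X i, Y i) with i < t. *)

Section Mints.
Context {R : realType} {K : nat}.
Implicit Types (D : seq ('I_K * R)) (theta : 'I_K -> R) (j : 'I_K)
  (Theta : set ('I_K -> R)) (Q : 'I_K -> R) (mu : 'I_K -> R) (sigma : R).

(* The maximum is seeded with mu j, itself one of the terms. *)
Definition gap mu j : R := \big[Order.max/mu j]_(k < K) mu k - mu j.

(* normal_pdf m s is the density of the normal distribution of mean m and
   standard deviation s. *)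
Definition likelihood sigma D theta : R :=
  \prod_(d <- D) normal_pdf (theta d.1) sigma d.2.

Definition optimal_params Theta j : set ('I_K -> R) :=
  [set v | Theta v /\ forall k, v k <= v j].

(* The likelihood is bounded in theta, so this is a true supremum; it is 0 when
   optimal_params Theta j is empty, since sup set0 = 0. *)
Definition profile_likelihood sigma Theta D j : R :=
  sup (likelihood sigma D @` optimal_params Theta j).

(* The case of no data is separate because there the formula would discard the
   arms j with optimal_params Theta j empty, whereas the prior need not. *)
Definition posterior Q sigma Theta D j : R :=
  if D is [::] then Q j else
  profile_likelihood sigma Theta D j * Q j /
    \sum_(k < K) profile_likelihood sigma Theta D k * Q k.

Definition uniform_prior j : R := K%:R^-1.

End Mints.

Section Interaction.
Context {d : measure_display} {Omega : measurableType d} {R : realType}.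
Context {K : nat} (P : probability Omega R).
Implicit Types (X : nat -> Omega -> 'I_K) (Y : nat -> Omega -> R).

(* f is a version of the conditional probability of A given the sub-sigma-algebra
   G. *)
Definition is_cond_probability (G : set (set Omega)) (A : set Omega)
    (f : Omega -> \bar R) : Prop :=
  [/\ forall B : set (\bar R), measurable B -> G (f @^-1` B),
      P.-integrable setT f &
      forall C, G C -> (\int[P]_(w in C) f w)%E = P (A `&` C)].

Definition dataset X Y (t : nat) (w : Omega) : seq ('I_K * R) :=
  [seq (X i w, Y i w) | i <- iota 0 t].

Definition arm_events X (t : nat) : set (set Omega) :=
  [set X t @^-1` [set j] | j in [set: 'I_K]].

Definition feedback_events Y (t : nat) : set (set Omega) :=
  [set Y t @^-1` B | B in [set B : set R | measurable B]].

Definition data_events X Y (t : nat) : set (set Omega) :=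
  \bigcup_(i in [set i | (i < t)%N]) (arm_events X i `|` feedback_events Y i).

(* Given the data before period t+1 and the arm X t, the feedback Y t has law
   nu (X t). *)
Definition bandit_feedback (nu : 'I_K -> probability (measurableTypeR R) R)
    X Y : Prop :=
  forall (t : nat) (B : set (measurableTypeR R)), measurable B ->
    is_cond_probability <<s data_events X Y t `|` arm_events X t >>
      (Y t @^-1` B) (fun w => nu (X t w) B).

(* Given the data before period t+1, the arm X t has law q (dataset X Y t). *)
Definition samples_from (q : seq ('I_K * R) -> 'I_K -> R) X Y : Prop :=
  forall (t : nat) (j : 'I_K),
    is_cond_probability <<s data_events X Y t >>
      (X t @^-1` [set j]) (fun w => (q (dataset X Y t w) j)%:E).

Definition regret (mu : 'I_K -> R) X (T : nat) (w : Omega) : R :=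
  \sum_(t < T) gap mu (X t w).

End Interaction.

(* Main.v *)
Require Import Defs.
From HB Require Import structures.
From mathcomp Require Import all_boot all_order all_algebra.
From mathcomp Require Import all_classical all_reals all_analysis.
From mathcomp Require Import measurable_realfun.
From mathcomp Require Import ring lra.
Import Order.TTheory GRing.Theory Num.Theory.
Import numFieldNormedType.Exports.
Local Open Scope classical_set_scope.
Local Open Scope ring_scope.

(** Write N_k(t) and S_k(t) for the number of pulls of arm k among the data
    available at time t and the sum of the centered rewards it produced, and let
    A_t = 1/2 sum_k S_k^2 / N_k.  The log-likelihood ratio of v to mu is
    -1/2 sum_k (N_k w_k^2 - 2 w_k S_k) with w = v - mu, so completing the square
    in each coordinate shows, for an arbitrary Theta containing mu, that

    - every arm has profile likelihood at most e^A_t L(mu), whence the best arm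
      is always sampled with probability at least e^(-A_t) / K
      ([posterior_optimal_ge]);
    - an arm j other than jstar is optimal only under v with v_j >= v_jstar, so
      it is sampled with probability at most
      exp (A_t / eta - (1 - eta)/2 Delta_j^2 N_j N_jstar / (N_j + N_jstar)),
      for every eta in ]0, 1[ ([posterior_wrong_le]).

    Hence everything rests on A_t = o(log t) almost surely.  A finite variance
    makes this a weak form of the law of the iterated logarithm.  It is obtained
    by truncating the rewards at the square root of the number of pulls and
    exhibiting a nonnegative supermartingale of the form
    S^4 / (n^2 (1 + log n)^(3/2)) + (number of truncated rewards)
    + (deterministic function of n), where S is now the truncated sum after n
    pulls.  A nonnegative supermartingale is almost surely bounded, so
    S^2 / n = O((log n)^(3/4)) ([deviation_bound]).  The supermartingale is indexed by the actual time and uses the conditional law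
    of the feedback, rather than an i.i.d. sequence of rewards for each arm.

    The same boundedness principle, applied to exponential supermartingales,
    compares the number of times an arm is pulled along a predictable set of
    times with the sum of its sampling probabilities over these times
    ([count_le_compensator]).  Since e^(-A_t) decays slower than any power of t,
    the best arm is pulled more than C log t times for every C.  If moreover
    N_j exceeds (1 + e) 2 log t / Delta_j^2, then
    N_j N_jstar / (N_j + N_jstar) exceeds (1 + e/2) 2 log t / Delta_j^2 for
    large t, so the sampling probability of j is at most t^(-1 - e/8), which is
    summable, and such pulls occur finitely often.  Thus N_j(T) <= (1 + e) 2 log T / Delta_j^2 + O(1)
    ([pathwise_pulls]), and summing Delta_j N_j(T) over j gives the bound. *)

(** * Nonnegative supermartingales are bounded *)

Lemma sub_sigma_measurable_fun {d d2} {Omega : measurableType d}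
    {T2 : measurableType d2} (G : set (set Omega)) (f : Omega -> T2) :
  <<s G >> `<=` measurable ->
  measurable_fun [set: g_sigma_algebraType G] f -> measurable_fun setT f.
Proof.
by move=> GM mf _ B mB; rewrite setTI; apply: GM; have := mf measurableT B mB;
  rewrite setTI.
Qed.

Lemma sigma_measurable_fun_le {d d2} {Omega : measurableType d}
    {T2 : measurableType d2} (G H : set (set Omega)) (f : Omega -> T2) :
  <<s G >> `<=` <<s H >> ->
  measurable_fun [set: g_sigma_algebraType G] f ->
  measurable_fun [set: g_sigma_algebraType H] f.
Proof.
by move=> GM mf _ B mB; rewrite setTI; apply: GM; have := mf measurableT B mB;
  rewrite setTI.
Qed.

Section maximal.
Context {d : measure_display} {Omega : measurableType d} {R : realType}.
Variables (P : probability Omega R) (G : nat -> set (set Omega)).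
Hypothesis GS : forall t, <<s G t >> `<=` <<s G t.+1 >>.
Hypothesis GM : forall t, <<s G t >> `<=` measurable.
Variable U : nat -> Omega -> R.
Hypothesis U_ge0 : forall t w, 0 <= U t w.
Hypothesis mU : forall t, measurable_fun [set: g_sigma_algebraType (G t)] (U t).
Hypothesis U_super : forall t C, <<s G t >> C ->
  (\int[P]_(w in C) (U t.+1 w)%:E <= \int[P]_(w in C) (U t w)%:E)%E.

Let below (l : R) n : set Omega := [set w | forall i, (i < n)%N -> U i w < l].

Let belowS l n : below l n.+1 = below l n `&` U n @^-1` `]-oo, l[.
Proof.
apply/seteqP; split=> w /=.
  move=> H; split; first by move=> i ni; apply: H; rewrite ltnS ltnW.
  by rewrite in_itv /=; apply: H.
move=> [H1]; rewrite in_itv /= => H2 i; rewrite ltnS leq_eqVlt => /orP[/eqP->//|].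
exact: H1.
Qed.

Let Gbelow l n : <<s G n >> (below l n).
Proof.
elim: n => [|n IH].
  rewrite (_ : below l 0 = setT); last by apply/seteqP; split => // w _ [].
  exact: (@measurableT _ (g_sigma_algebraType (G 0))).
rewrite belowS; apply: GS.
apply: (@measurableI _ (g_sigma_algebraType (G n))); first exact: IH.
by rewrite -[X in measurable X]setTI; exact: mU.
Qed.

Let mUT t : measurable_fun setT (U t).
Proof. exact: sub_sigma_measurable_fun (GM t) (mU t). Qed.

(** Doob's maximal inequality in a subtraction-free form that is proved by
    induction: passing from n to n.+1, the mass that leaves [below l n] has
    energy at least l, and the rest cannot gain energy. *)
Lemma supermartingale_maximal (l : R) n : 0 <= l ->
  (\int[P]_(w in below l n) (U n w)%:E + l%:E * P (~` below l n)
    <= \int[P]_w (U 0 w)%:E)%E.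
Proof.
move=> l0; elim: n => [|n IH].
  rewrite (_ : below l 0 = setT); last by apply/seteqP; split => // w _ [].
  by rewrite setCT measure0 mule0 adde0.
apply: le_trans IH.
have mB m : measurable (below l m) by exact: GM (Gbelow l m).
have mBD : measurable (below l n `\` below l n.+1) by exact: measurableD.
have mUE D : measurable_fun D (fun w => (U n w)%:E).
  by apply/measurable_EFinP; exact: measurable_funS (mUT n).
have BS : below l n.+1 `<=` below l n by rewrite belowS; exact: subIsetl.
have -> : ~` below l n.+1 = ~` below l n `|` (below l n `\` below l n.+1).
  apply/seteqP; split=> w /=; first by have [|] := pselect (below l n w); [right|left].
  by move=> [H /BS|[]].
rewrite measureU//; last first.
  - by apply/seteqP; split => // w /= [? []].
  - exact: measurableC.
rewrite ge0_muleDr//.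
rewrite [leLHS]addeCA [leRHS]addeC; apply: leeD => //.
rewrite -{2}(setDUK BS) ge0_integral_setU//; last 2 first.
- by move=> x _; rewrite lee_fin.
- by apply/disj_set2P; rewrite setDIK.
apply: leeD.
  apply: U_super; rewrite belowS.
  apply: (@measurableI _ (g_sigma_algebraType (G n))); first exact: Gbelow.
  by rewrite -[X in measurable X]setTI; exact: mU.
rewrite -integral_cst//; apply: ge0_le_integral => //.
move=> w []; rewrite belowS /= => H /not_andP[//|]; rewrite in_itv/= lee_fin.
by move/negP; rewrite -leNgt.
Qed.

(** The set where U is unbounded is contained, for every l, in the set where U
    reaches l, whose probability is at most E(U_0) / l. *)
Lemma supermartingale_bounded : (\int[P]_w (U 0 w)%:E < +oo)%E ->
  {ae P, forall w, exists M, forall t, U t w <= M}.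
Proof.
move=> U0oo.
pose c := fine (\int[P]_w (U 0 w)%:E)%E.
have cE : (\int[P]_w (U 0 w)%:E = c%:E)%E.
  by rewrite fineK// ge0_fin_numE// integral_ge0// => w _; rewrite lee_fin.
have mB l m : measurable (below l m) by exact: GM (Gbelow l m).
pose A l := \bigcup_n ~` below l n.
have mA l : measurable (A l) by apply: bigcupT_measurable => n; exact: measurableC.
have PA l : 0 < l -> (P (A l) <= (c / l)%:E)%E.
  move=> l0.
  have /cvg_lim <- // : P \o (fun n => ~` below l n) @ \oo --> P (A l).
    apply: nondecreasing_cvg_mu => //.
    - by move=> i; exact: measurableC.
    - exact: mA.
    - move=> n m nm; apply/subsetPset; apply: subsetC => w /= H i ni.
      by apply: H; exact: leq_trans nm.
  apply: lime_le.
    apply: ereal_nondecreasing_is_cvgn => n m nm /=.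
    apply: le_measure; rewrite ?inE; [exact: measurableC|exact: measurableC|].
    by apply: subsetC => w /= H i ni; apply: H; exact: leq_trans nm.
  apply: nearW => n /=.
  have := @supermartingale_maximal l n (ltW l0); rewrite cE => H.
  rewrite EFinM lee_pdivlMr// muleC; apply: le_trans H; apply: leeDr.
  by apply: integral_ge0 => w _; rewrite lee_fin.
exists (\bigcap_n A n.+1%:R); split.
- by apply: bigcapT_measurable => n.
- apply/eqP; rewrite eq_le measure_ge0 andbT; apply/lee_addgt0Pr => e e0; rewrite add0e.
  have c0 : 0 <= c by rewrite -lee_fin -cE integral_ge0// => w _; rewrite lee_fin.
  pose n := Num.truncn (c / e).
  have ce : c / n.+1%:R <= e.
    rewrite ler_pdivrMr// mulrC -ler_pdivrMr//; apply/ltW.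
    by rewrite /n; apply: truncnS_gt.
  apply: (@le_trans _ _ (P (A n.+1%:R))).
    apply: le_measure; rewrite ?inE//; first exact: bigcapT_measurable.
    by apply: bigcap_inf.
  by apply: le_trans (PA _ _) _ => //; rewrite lee_fin.
- move=> w /= H n _; apply: contrapT => nA; apply: H; exists n.+1%:R => t.
  rewrite leNgt; apply/negP => lt; apply: nA; exists t.+1 => //= /(_ t (ltnSn _)).
  by rewrite ltNge (ltW lt).
Qed.

End maximal.

(** * Disintegration along a conditional law *)

Section disintegration.
Context {d d2 : measure_display} {Omega : measurableType d}
  {T2 : measurableType d2} {R : realType}.
Variables (P : probability Omega R) (G : set (set Omega)).
Hypothesis GM : <<s G >> `<=` measurable.
Variables (D : set Omega) (mD : measurable D).

Local Notation TG := (g_sigma_algebraType G).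

(** P conditioned on D, without normalization, as a measure on the coarser
    sigma-algebra generated by G. *)
Definition trace_measure (A : set TG) : \bar R := mrestr P mD A.

Let trace0 : trace_measure set0 = 0%E.
Proof. exact: (measure0 (mrestr P mD)). Qed.

Let trace_ge0 A : (0 <= trace_measure A)%E.
Proof. exact: (measure_ge0 (mrestr P mD)). Qed.

Let trace_sigma_additive : semi_sigma_additive trace_measure.
Proof.
move=> F mF tF mUF.
apply: (@measure_semi_sigma_additive _ _ _ (mrestr P mD)) => //.
- by move=> i; apply: GM; exact: mF.
- exact: GM.
Qed.

HB.instance Definition _ := isMeasure.Build _ _ _ trace_measure
  trace0 trace_ge0 trace_sigma_additive.

Let trace_fin : fin_num_fun trace_measure.
Proof.
move=> A mA; rewrite /trace_measure /mrestr.
by rewrite fin_num_measure//; apply: measurableI => //; exact: GM.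
Qed.

HB.instance Definition _ :=
  Measure_isFinite.Build _ _ _ trace_measure trace_fin.

(** If, on D, the variable Y is independent of G with law nu, then Y can be
    integrated out of any joint function of the past and of Y.  The joint law of
    (w, Y w) on D is the product of [trace_measure] and nu, because the two
    agree on rectangles; Tonelli's theorem concludes. *)
Lemma integral_independent (Y : Omega -> T2) (nu : probability T2 R)
    (F : TG * T2 -> \bar R) :
  measurable_fun setT Y ->
  (forall C B, <<s G >> C -> measurable B ->
     P (C `&` D `&` Y @^-1` B) = (P (C `&` D) * nu B)%E) ->
  measurable_fun setT F -> (forall z, (0 <= F z)%E) ->
  (\int[P]_(w in D) F (w, Y w) = \int[P]_(w in D) \int[nu]_y F (w, y))%E.
Proof.
move=> mY YD mF F0.
pose phi (w : Omega) : TG * T2 := (w, Y w).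
have mid : measurable_fun setT (fun w : Omega => w : TG).
  by move=> _ B mB; rewrite setTI; exact: GM.
have mphi : measurable_fun setT phi by exact/measurable_fun_pair.
have mfF : measurable_fun [set: TG] (fun w => \int[nu]_y F (w, y))%E.
  exact: measurable_fun_fubini_tonelli_F.
have restrE (f : Omega -> \bar R) : measurable_fun setT f -> (forall w, 0 <= f w)%E ->
    (\int[P]_(w in D) f w = \int[mrestr P mD]_w f w)%E.
  move=> mf f0; rewrite -(setUv D) ge0_integral_setU; first last.
  - by apply/disj_set2P; rewrite setICr.
  - by [].
  - by rewrite setUv.
  - exact: measurableC.
  - exact: mD.
  rewrite [X in (_ + X)%E](_ : _ = 0%E) ?adde0.
    by apply: eq_measure_integral => A mA /setIidl AD; rewrite -[in LHS]AD.
  apply: null_set_integral; first exact: measurableC.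
  - exact: measurable_funS mf.
  - by rewrite /= /mrestr setICl measure0.
rewrite (restrE (F \o phi)); last 2 first.
- exact: measurableT_comp.
- by move=> w; exact: F0.
rewrite (restrE (fun w => \int[nu]_y F (w, y))%E); last 2 first.
- exact: sub_sigma_measurable_fun mfF.
- by move=> w; exact: integral_ge0.
have := ge0_integral_pushforward mphi (mrestr P mD) measurableT mF.
rewrite preimage_setT => <-; last by move=> z _; exact: F0.
have := ge0_integral_pushforward mid (mrestr P mD) measurableT mfF.
rewrite preimage_setT => <-; last by move=> z _; exact: integral_ge0.
transitivity (\int[trace_measure \x nu]_z F z)%E.
  apply: eq_measure_integral => A mA _; apply/esym/product_measure_unique => //.
  move=> C B mC mB; rewrite /pushforward /trace_measure /mrestr /= -YD//.
  by congr (P _); apply/seteqP; split => w /= [[]].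
rewrite fubini_tonelli1//; exact: eq_measure_integral.
Qed.

End disintegration.

Section layer_cake.
Context {d : measure_display} {Omega : measurableType d} {R : realType}.
Variables (P : probability Omega R) (G : set (set Omega)).
Hypothesis GM : <<s G >> `<=` measurable.

Let strip (h : Omega -> R) : set (Omega * R) := [set z | 0 <= z.2 < h z.1].

Let stripE (h : Omega -> R) (w : Omega) (x : R) :
  \1_(strip h) (w, x) = (0 <= x < h w)%R%:R :> R.
Proof. by rewrite indicE; congr (nat_of_bool _)%:R; apply/idP/idP; rewrite inE. Qed.

Let measurable_strip h : measurable_fun setT h -> measurable (strip h).
Proof.
move=> mh.
have mb : measurable_fun setT (fun z : Omega * R => (0 <= z.2) && (z.2 < h z.1)).
  apply: measurable_and; first exact: measurable_fun_ler.
  by apply: measurable_fun_ltr => //; exact: measurableT_comp.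
rewrite -[X in measurable X]setTI; exact: (mb measurableT [set true]).
Qed.

(** h is the integral over x >= 0 of the indicator of x < h. *)
Let layer_cake (h u : Omega -> R) :
  measurable_fun setT h -> (forall w, 0 <= h w) ->
  measurable_fun setT u -> (forall w, 0 <= u w) ->
  (\int[P]_w (h w * u w)%:E =
   \int[@lebesgue_measure R]_(x in `[0%R, +oo[)
     \int[P]_(w in [set w : Omega | (x < h w)%R]) (u w)%:E)%E.
Proof.
move=> mh h0 mu u0.
pose f (z : Omega * R) : \bar R := (\1_(strip h) z * u z.1)%:E.
have mf : measurable_fun setT f.
  apply/measurable_EFinP; apply: measurable_funM.
    by apply: measurable_indic; exact: measurable_strip.
  exact: measurableT_comp.
transitivity (\int[P]_w \int[@lebesgue_measure R]_x f (w, x))%E.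
  apply: eq_integral => w _.
  under eq_integral => x _.
    rewrite /f mulrC EFinM (_ : \1_(strip h) (w, x) = \1_`[0, h w[ x); last first.
      by rewrite stripE indicE mem_setE in_itv.
    over.
  rewrite /= ge0_integralZl_EFin//; last exact/measurable_EFinP.
  rewrite integral_indic// setIT.
  rewrite /= lebesgue_measure_itv/= lte_fin mulrC EFinM.
  by case: ltgtP (h0 w) => // [_|<-] _; rewrite ?sube0// mule0.
rewrite fubini_tonelli//=; last first.
  by move=> z; rewrite lee_fin mulr_ge0.
rewrite [RHS]integral_mkcond/=; apply: eq_integral => x _.
rewrite patchE mem_setE in_itv /= andbT; case: ifPn => x0.
  rewrite [RHS]integral_mkcond; apply: eq_integral => w _.
  rewrite /f patchE stripE x0 /=.
  rewrite (_ : (w \in _) = (x < h w)); last by apply/idP/idP; rewrite inE.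
  by case: ltP; rewrite ?mul1r ?mul0r.
rewrite integral0_eq// => w _.
by rewrite /f stripE (negbTE x0) mul0r.
Qed.

(** Two weights with the same integral over each set of G have the same
    conditional expectation, so they may be exchanged against a nonnegative
    G-measurable factor h: the layers of h belong to G. *)
Lemma integral_mul_sigma (h u v : Omega -> R) :
  measurable_fun [set: g_sigma_algebraType G] h -> (forall w, 0 <= h w) ->
  measurable_fun setT u -> (forall w, 0 <= u w) ->
  measurable_fun setT v -> (forall w, 0 <= v w) ->
  (forall C, <<s G >> C ->
    \int[P]_(w in C) (u w)%:E = \int[P]_(w in C) (v w)%:E)%E ->
  (\int[P]_w (h w * u w)%:E = \int[P]_w (h w * v w)%:E)%E.
Proof.
move=> mh h0 mu u0 mv v0 uv.
have mhO : measurable_fun setT h by exact: sub_sigma_measurable_fun GM mh.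
rewrite !layer_cake//; apply: eq_integral => x _; apply: uv.
have := mh measurableT `](x : R), +oo[%classic (measurable_itv _).
rewrite setTI; congr (<<s G >> _).
by apply/seteqP; split => w /=; rewrite in_itv /= andbT.
Qed.

End layer_cake.

(** * Counts of events and sums of conditional probabilities *)

Section count_vs_compensator.
Context {d : measure_display} {Omega : measurableType d} {R : realType}.
Variables (P : probability Omega R) (G : nat -> set (set Omega)).
Hypothesis GS : forall t, <<s G t >> `<=` <<s G t.+1 >>.
Hypothesis GM : forall t, <<s G t >> `<=` measurable.
Variables (A E : nat -> set Omega) (q : nat -> Omega -> R).
Hypothesis GA : forall t, <<s G t.+1 >> (A t).
Hypothesis GE : forall t, <<s G t >> (E t).
Hypothesis mq : forall t, measurable_fun [set: g_sigma_algebraType (G t)] (q t).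
Hypothesis q01 : forall t w, 0 <= q t w <= 1.
Hypothesis qA : forall t C, <<s G t >> C ->
  (\int[P]_(w in C) (q t w)%:E = P (A t `&` C))%E.

(** A t occurs at time t with conditional probability q t; E t is known before
    time t and selects the times that count. *)
Definition event_count t w : R := \sum_(s < t) \1_(A s) w * \1_(E s) w.
Definition compensator t w : R := \sum_(s < t) q s w * \1_(E s) w.

Let V l t w := expR (l * event_count t w - (expR l - 1) * compensator t w).

Let GSle s t : (s <= t)%N -> <<s G s >> `<=` <<s G t >>.
Proof.
elim: t => [|t IH]; first by rewrite leqn0 => /eqP->.
by rewrite leq_eqVlt => /orP[/eqP->//|/IH st]; apply: subset_trans st (GS t).
Qed.

Let mcount t : measurable_fun [set: g_sigma_algebraType (G t)] (event_count t).
Proof.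
apply: measurable_sum => s; apply: measurable_funM.
  by apply: (@measurable_indic _ (g_sigma_algebraType (G t))); exact: GSle (GA s).
apply: (@measurable_indic _ (g_sigma_algebraType (G t))).
by apply: GSle (GE s); exact: ltnW.
Qed.

Let mcomp t : measurable_fun [set: g_sigma_algebraType (G t.+1)] (compensator t.+1).
Proof.
apply: measurable_sum => s; apply: measurable_funM.
  by apply: sigma_measurable_fun_le (mq s); exact: GSle (ltnW _).
apply: (@measurable_indic _ (g_sigma_algebraType (G t.+1))).
by apply: GSle (GE s); exact: ltnW.
Qed.

Let mV l t : measurable_fun [set: g_sigma_algebraType (G t)] (V l t).
Proof.
apply: measurableT_comp => //; apply: measurable_funB.
  exact: measurable_funM.
apply: measurable_funM => //.
case: t => [|t]; last exact: mcomp.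
rewrite (_ : compensator 0 = cst 0)//.
by apply/funext => w; rewrite /compensator big_ord0.
Qed.

(** Given the past, the exponential of l times the indicator of A has
    expectation 1 + (expR l - 1) q, on the times selected by E. *)
Let step_lin l t C : <<s G t >> C ->
  (\int[P]_(w in C) (1 + (expR l - 1) * (\1_(A t) w * \1_(E t) w))%:E
   = \int[P]_(w in C) (1 + (expR l - 1) * (q t w * \1_(E t) w))%:E)%E.
Proof.
move=> GC.
have mC := GM _ _ GC. have mE := GM _ _ (GE t). have mA := GM _ _ (GA t).
have mqt : measurable_fun setT (q t) by exact: sub_sigma_measurable_fun (GM t) (mq t).
have lin (f : Omega -> R) : measurable_fun setT f -> (forall w, 0 <= f w <= 1) ->
  (\int[P]_(w in C) (1 + (expR l - 1) * f w)%:E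
    = P C + (expR l - 1)%:E * \int[P]_(w in C) (f w)%:E)%E.
  move=> mf f01.
  have fint : P.-integrable C (EFin \o f).
    apply: measurable_bounded_integrable => //.
    - by rewrite ltey_eq fin_num_measure.
    - exact: measurable_funS mf.
    - exists 1; split => // x x1 w _ /=; rewrite (le_trans _ (ltW x1))//.
      by have /andP[f0 f1] := f01 w; rewrite ger0_norm.
  under eq_integral do rewrite EFinD EFinM.
  rewrite integralD//=.
  - by rewrite integralZl// integral_cst// mul1e.
  - exact: finite_measure_integrable_cst.
  - exact: integrableZl.
rewrite !lin//.
- congr (_ + _ * _)%E.
  rewrite (eq_integral (fun w => (\1_(A t `&` E t) w)%:E)); last by move=> w _; rewrite indicI.
  rewrite integral_indic//; last exact: measurableI.
  transitivity (P (A t `&` (E t `&` C))); first by rewrite setIA.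
  rewrite -qA; last first.
    by apply: (@measurableI _ (g_sigma_algebraType (G t))) => //; exact: GE.
  rewrite setIC integral_mkcondr; apply: eq_integral => w _.
  rewrite patchE indicE; by case: ifP; rewrite ?mulr1 ?mulr0.
- by apply: measurable_funM => //; exact: measurable_indic.
- move=> w; have /andP[q0 q1] := q01 t w.
  by rewrite indicE; case: (w \in _); rewrite ?mulr1 ?mulr0 ?q0 ?lexx ?ler01.
- by apply: measurable_funM => //; exact: measurable_indic.
- by move=> w; rewrite !indicE; case: (w \in _); case: (w \in _);
  rewrite ?mulr1 ?mulr0 ?lexx ?ler01.
Qed.

Let V_super l t C : <<s G t >> C ->
  (\int[P]_(w in C) (V l t.+1 w)%:E <= \int[P]_(w in C) (V l t w)%:E)%E.
Proof.
move=> GC; set k := expR l - 1.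
pose h w := \1_C w * (V l t w * expR (- (k * (q t w * \1_(E t) w)))).
pose u w := 1 + k * (\1_(A t) w * \1_(E t) w).
pose v w := 1 + k * (q t w * \1_(E t) w).
have mC := GM _ _ GC. have mE := GM _ _ (GE t). have mA := GM _ _ (GA t).
have k1 : -1 <= k by rewrite /k lerBrDr addNr expR_ge0.
have lin0 x : 0 <= x <= 1 -> 0 <= 1 + k * x by move=> /andP[]; nra.
have qE w : 0 <= q t w * \1_(E t) w <= 1.
  have /andP[q0 q1] := q01 t w.
  by rewrite indicE; case: (w \in _); rewrite ?mulr1 ?mulr0 ?q0 ?lexx ?ler01.
have mqE : measurable_fun [set: g_sigma_algebraType (G t)] (fun w => k * (q t w * \1_(E t) w)).
  apply: measurable_funM => //; apply: measurable_funM; first exact: mq.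
  by apply: (@measurable_indic _ (g_sigma_algebraType (G t))); exact: GE.
have mh : measurable_fun [set: g_sigma_algebraType (G t)] h.
  apply: measurable_funM.
    by apply: (@measurable_indic _ (g_sigma_algebraType (G t))).
  apply: measurable_funM; first exact: mV.
  by apply: measurableT_comp => //; exact: measurableT_comp.
have mVO s : measurable_fun setT (V l s) by exact: sub_sigma_measurable_fun (GM s) (mV l s).
rewrite [leLHS]integral_mkcond [leRHS]integral_mkcond.
have -> : (\int[P]_w ((fun w => (V l t.+1 w)%:E) \_ C) w = \int[P]_w (h w * u w)%:E)%E.
  apply: eq_integral => w _; rewrite patchE /h indicE; case: ifP => _; last first.
    by rewrite mul0r mul0r.
  rewrite mul1r; congr EFin; rewrite /V /event_count /compensator !big_ord_recr /=.
  have -> : u w = expR (l * (\1_(A t) w * \1_(E t) w)).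
    rewrite /u !indicE; case: (w \in A t); case: (w \in E t);
      by rewrite /= ?(mulr1, mulr0) ?expR0 ?addr0// /k addrC subrK.
  by rewrite -!expRD; congr expR; rewrite /k; ring.
rewrite (@integral_mul_sigma _ _ _ P _ (GM t) h u v mh _ _ _ _ _ (step_lin l t)).
- apply: ge0_le_integral => //.
  + move=> w _; rewrite lee_fin mulr_ge0//; last exact: lin0.
    by rewrite /h mulr_ge0// mulr_ge0// expR_ge0.
  + apply/measurable_EFinP; apply: measurable_funM.
      exact: sub_sigma_measurable_fun (GM t) mh.
    apply: measurable_funD => //.
    exact: sub_sigma_measurable_fun (GM t) mqE.
  + apply/(measurable_restrictT _ mC).1; apply/measurable_EFinP.
    exact: measurable_funS (mVO t).
  + move=> w _; rewrite patchE /h indicE; case: ifP => _; last by rewrite !mul0r.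
    rewrite mul1r lee_fin -[leRHS]mulr1 -mulrA ler_wpM2l ?expR_ge0//.
    by rewrite expRN mulrC ler_pdivrMr ?expR_gt0// mul1r expR_ge1Dx.
- by move=> w; rewrite /h mulr_ge0// mulr_ge0// expR_ge0.
- apply: measurable_funD => //; apply: measurable_funM => //.
  by apply: measurable_funM; exact: measurable_indic.
- by move=> w; apply: lin0; rewrite !indicE; case: (w \in _); case: (w \in _);
  rewrite ?mulr1 ?mulr0 ?lexx ?ler01.
- apply: measurable_funD => //.
  exact: sub_sigma_measurable_fun (GM t) mqE.
- by move=> w; exact: lin0.
Qed.

(** exp (l * count - (e^l - 1) * compensator) is a supermartingale, since
    1 + (e^l - 1) q <= exp ((e^l - 1) q); it is thus bounded.  Taking l = 1 bounds
    the count from above and l = -1 bounds it from below. *)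
Lemma count_le_compensator (l : R) : {ae P, forall w, exists M, forall t,
  l * event_count t w <= (expR l - 1) * compensator t w + M}.
Proof.
have V0 : (\int[P]_w (V l 0 w)%:E < +oo)%E.
  under eq_integral => w _ do
    rewrite /V /event_count /compensator !big_ord0 !mulr0 subr0 expR0.
  by rewrite integral_cst// mul1e; apply: le_lt_trans (ltry 1); exact: probability_le1.
have := supermartingale_bounded P G GS GM _ (fun t w => expR_ge0 _) (mV l) (V_super l) V0.
apply: filterS => w [M HM]; exists M => t.
rewrite -lerBlDl; apply: le_trans (HM t).
by apply: le_trans (expR_ge1Dx _); rewrite lerDr.
Qed.

End count_vs_compensator.

(** * One step of the quartic Lyapunov function *)

Section lyapunov_scale.
Context {R : realType}.
Implicit Types (m : nat) (s z v a : R).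

(** The normalization of S^4 after m - 1 pulls is m^2 (1 + ln m)^(3/2).  The
    exponent 3/2 lies strictly between 1, which makes the sum of
    1 / (m (1 + ln m)^(3/2)) finite, and 2, which makes a bounded ratio imply
    S^2 / m = o(ln m). *)
Definition sqrt_log m : R := Num.sqrt (1 + ln m%:R).
Definition quartic_scale m : R := m%:R ^+ 2 * sqrt_log m ^+ 3.

Lemma sqrt_log_ge1 m : (0 < m)%N -> 1 <= sqrt_log m.
Proof.
by move=> m0; rewrite -[leLHS]sqrtr1 ler_wsqrtr// lerDl ln_ge0// ler1n.
Qed.

Lemma sqrt_log_sq m : (0 < m)%N -> sqrt_log m ^+ 2 = 1 + ln m%:R.
Proof. by move=> m0; rewrite sqr_sqrtr// addr_ge0// ln_ge0// ler1n. Qed.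

Lemma quartic_scale_ge m : (0 < m)%N -> m%:R ^+ 2 <= quartic_scale m.
Proof.
by move=> m0; rewrite ler_peMr ?sqr_ge0// exprn_ege1// sqrt_log_ge1.
Qed.

Lemma lnS_sub_ln m : (0 < m)%N -> m.+1%:R^-1 <= ln m.+1%:R - ln m%:R :> R.
Proof.
move=> m0.
have M0 : 0 < m%:R :> R by rewrite ltr0n.
have M1 : 0 < m.+1%:R :> R by rewrite ltr0n.
rewrite -lerN2 opprB -ln_div ?posrE//.
have -> : m%:R / m.+1%:R = 1 + - m.+1%:R^-1 :> R.
  by rewrite -natr1; field; rewrite natr1 gt_eqF.
by apply: le_ln1Dx; rewrite ltrN2 invf_lt1// ltr1n.
Qed.

(** The summands 1 / (m (1 + ln m)^(3/2)) are dominated by a telescoping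
    difference. *)
Lemma sqrt_log_step m : (0 < m)%N ->
  m.+1%:R^-1 / sqrt_log m.+1 ^+ 3 <= 2 * ((sqrt_log m)^-1 - (sqrt_log m.+1)^-1).
Proof.
move=> m0; have r1 := sqrt_log_ge1 m m0; have r1' := sqrt_log_ge1 m.+1 isT.
have := lnS_sub_ln m m0.
have -> : ln m.+1%:R - ln m%:R = sqrt_log m.+1 ^+ 2 - sqrt_log m ^+ 2.
  by rewrite !sqrt_log_sq//; ring.
have q0 : 0 < m.+1%:R^-1 :> R by rewrite invr_gt0 ltr0n.
move: (sqrt_log m) (sqrt_log m.+1) (m.+1%:R^-1) r1 r1' q0 => r r' q r1 r1' q0 H.
have r0 : 0 < r by lra. have r0' : 0 < r' by lra.
have rr : r <= r' by nra.
rewrite ler_pdivrMr ?exprn_gt0//.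
have -> : 2 * (r^-1 - r'^-1) * r' ^+ 3 = 2 * (r' - r) * r' ^+ 2 / r.
  by field; rewrite !gt_eqF.
rewrite ler_pdivlMr//.
apply: (@le_trans _ _ ((r' ^+ 2 - r ^+ 2) * r)); first by rewrite ler_wpM2r// ltW.
have -> : r' ^+ 2 - r ^+ 2 = (r' - r) * (r' + r) by ring.
have : (r' + r) * r <= 2 * r' ^+ 2 by nra.
nra.
Qed.

Lemma quartic_scale_step m : (0 < m)%N ->
  quartic_scale m * (1 + 2 / m%:R) <= quartic_scale m.+1.
Proof.
move=> m0; have r1 := sqrt_log_ge1 m m0.
have M0 : 0 < m%:R :> R by rewrite ltr0n.
have -> : quartic_scale m * (1 + 2 / m%:R) = (m%:R ^+ 2 + 2 * m%:R) * sqrt_log m ^+ 3.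
  by rewrite /quartic_scale; field; rewrite gt_eqF.
apply: ler_pM.
- by rewrite addr_ge0 ?sqr_ge0// mulr_ge0// ltW.
- by rewrite exprn_ge0// sqrtr_ge0.
- by rewrite -natr1; nra.
- rewrite lerXn2r ?nnegrE ?sqrtr_ge0// ler_wsqrtr// lerD2l ler_ln ?posrE ?ltr0n//.
  by rewrite ler_nat.
Qed.

(** In expectation a step adds to s^4 at most the terms with the factor v,
    where v is the variance.  With b = |s| / sqrt m these terms are of order
    m (b^3 v + b^2 v), whereas the growth of the normalization removes 2 m b^4;
    what may remain, at most m (2 v^2 + 4 v)^2, is paid by the decrease of
    the term in 1 / sqrt_log. *)
Lemma drift_dominates v s m : 0 <= v -> (0 < m)%N ->
  (s ^+ 4 + (4 * `|s| ^+ 3 / Num.sqrt m%:R + 8 * s ^+ 2) * v) / quartic_scale m.+1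
    + 2 * (2 * v ^+ 2 + 4 * v) ^+ 2 / sqrt_log m.+1
  <= s ^+ 4 / quartic_scale m + 2 * (2 * v ^+ 2 + 4 * v) ^+ 2 / sqrt_log m.
Proof.
move=> v0 m0; set C := (2 * v ^+ 2 + 4 * v) ^+ 2.
have M0 : 0 < m%:R :> R by rewrite ltr0n.
have g0 : 0 < quartic_scale m by apply: lt_le_trans (quartic_scale_ge m m0); rewrite exprn_gt0.
have G0 : 0 < quartic_scale m.+1.
  by apply: lt_le_trans (quartic_scale_ge m.+1 isT); rewrite exprn_gt0// ltr0n.
have C0 : 0 <= C by rewrite sqr_ge0.
pose b := `|s| / Num.sqrt m%:R.
have q0 : 0 < Num.sqrt m%:R :> R by rewrite sqrtr_gt0.
have b0 : 0 <= b by rewrite divr_ge0// ltW.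
have sb : `|s| = b * Num.sqrt m%:R by rewrite /b divfK// gt_eqF.
have s2 : s ^+ 2 = m%:R * b ^+ 2.
  by rewrite -real_normK ?num_real// sb exprMn sqr_sqrtr ?ltW// mulrC.
have s4 : s ^+ 4 = m%:R ^+ 2 * b ^+ 4.
  by rewrite (_ : 4 = 2 * 2)%N// exprM s2 exprMn -exprM.
have s3 : `|s| ^+ 3 / Num.sqrt m%:R = m%:R * b ^+ 3.
  rewrite sb exprMn -mulrA mulrC; congr (_ * _).
  by rewrite exprS mulrAC divff ?gt_eqF// mul1r sqr_sqrtr// ltW.
have key : 4 * b ^+ 3 * v + 8 * b ^+ 2 * v <= 2 * b ^+ 4 + C.
  have h1 : 0 <= (b ^+ 2 - 2 * v * b) ^+ 2 by rewrite sqr_ge0.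
  have h2 : 0 <= (b ^+ 2 - (2 * v ^+ 2 + 4 * v)) ^+ 2 by rewrite sqr_ge0.
  by rewrite /C; lra.
have t1 : 2 * s ^+ 4 / m%:R <= s ^+ 4 * (quartic_scale m.+1 / quartic_scale m - 1).
  have : 1 + 2 / m%:R <= quartic_scale m.+1 / quartic_scale m.
    by rewrite ler_pdivlMr// mulrC; exact: quartic_scale_step.
  move=> H; have -> : 2 * s ^+ 4 / m%:R = s ^+ 4 * (2 / m%:R) by ring.
  by apply: ler_wpM2l; [rewrite exprn_even_ge0|lra].
have t2 : C * m.+1%:R <= 2 * C * ((sqrt_log m)^-1 - (sqrt_log m.+1)^-1) * quartic_scale m.+1.
  have S0 : 0 < sqrt_log m.+1 by apply: lt_le_trans (sqrt_log_ge1 m.+1 isT).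
  have := sqrt_log_step m m0 => H.
  have {H} : m.+1%:R <= 2 * ((sqrt_log m)^-1 - (sqrt_log m.+1)^-1) * quartic_scale m.+1.
    apply: le_trans (ler_wpM2r (ltW G0) H); rewrite /quartic_scale.
    by rewrite le_eqVlt; apply/orP; left; apply/eqP; field; rewrite !gt_eqF// addr_gt0.
  move=> /(ler_wpM2l C0) /le_trans; apply; rewrite le_eqVlt; apply/orP; left; apply/eqP; ring.
have t3 : 2 * s ^+ 4 / m%:R = 2 * m%:R * b ^+ 4.
  by rewrite s4; field; rewrite gt_eqF.
suff : (s ^+ 4 + (4 * `|s| ^+ 3 / Num.sqrt m%:R + 8 * s ^+ 2) * v) / quartic_scale m.+1
    <= s ^+ 4 / quartic_scale m + 2 * C * ((sqrt_log m)^-1 - (sqrt_log m.+1)^-1) by lra.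
rewrite ler_pdivrMr// [leRHS]mulrDl.
have -> : s ^+ 4 / quartic_scale m * quartic_scale m.+1
    = s ^+ 4 + s ^+ 4 * (quartic_scale m.+1 / quartic_scale m - 1).
  by ring.
have t4 : m%:R * (4 * b ^+ 3 * v + 8 * b ^+ 2 * v) <= m%:R * (2 * b ^+ 4 + C).
  by rewrite ler_pM2l.
have t5 : C * m%:R <= C * m.+1%:R by rewrite ler_wpM2l// ler_nat.
have -> : 4 * `|s| ^+ 3 / Num.sqrt m%:R = 4 * (m%:R * b ^+ 3) by rewrite -s3 mulrA.
by rewrite s2; lra.
Qed.

Definition truncate m z : R := if z ^+ 2 <= m%:R then z else 0.

(** This bounds the sum over i > n of min (a^2 / i^2, 1), that is, for
    a = z^2, the future contributions of one law to the normalized fourth moments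
    of the truncated rewards and to the number of truncations; it is at most 4 a, so
    its mean is finite as soon as the variance is. *)
Definition tail_weight n a : R := 4 * a ^+ 2 / (n%:R + a).

(** The first summand is min (a^2 / (n+1)^2, 1), the contribution of the
    pull number n + 1. *)
Lemma tail_weight_step n a : 0 <= a ->
  (if a <= n.+1%:R then a ^+ 2 / n.+1%:R ^+ 2 else 1)
    + tail_weight n.+1 a <= tail_weight n a.
Proof.
rewrite le_eqVlt => /orP[/eqP<-|a0].
  by rewrite ler0n expr0n /= mul0r add0r /tail_weight expr0n/= mulr0 !mul0r.
rewrite -lerBrDr /tail_weight.
have M1 : 1 <= n.+1%:R :> R by rewrite ler1n.
have -> : n%:R = n.+1%:R - 1 :> R by rewrite -natr1 addrK.
move: (n.+1%:R) M1 => m m1.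
have m0 : 0 < m - 1 + a by lra.
have m0' : 0 < m + a by lra.
have -> : 4 * a ^+ 2 / (m - 1 + a) - 4 * a ^+ 2 / (m + a)
    = 4 * a ^+ 2 / ((m - 1 + a) * (m + a)).
  by field; rewrite !gt_eqF.
rewrite ler_pdivlMr ?mulr_gt0//.
case: (leP a m) => am; last first.
  rewrite mul1r (_ : 4 * a ^+ 2 = (2 * a) * (2 * a)); last by ring.
  by apply: ler_pM; lra.
have -> : a ^+ 2 / m ^+ 2 * ((m - 1 + a) * (m + a))
    = a ^+ 2 * ((m - 1 + a) * (m + a) / m ^+ 2) by ring.
rewrite mulrC ler_wpM2r ?sqr_ge0// ler_pdivrMr ?exprn_gt0//; last by lra.
rewrite (_ : 4 * m ^+ 2 = (2 * m) * (2 * m)); last by ring.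
by apply: ler_pM; lra.
Qed.

Lemma tail_weight_le n a : 0 <= a -> 0 <= tail_weight n a <= 4 * a.
Proof.
rewrite le_eqVlt => /orP[/eqP<-|a0].
  by rewrite /tail_weight expr0n/= mulr0 !mul0r lexx.
have na : 0 < n%:R + a :> R by rewrite ltr_wpDl.
rewrite /tail_weight; apply/andP; split.
  by rewrite divr_ge0 ?ltW// mulr_gt0// exprn_gt0.
rewrite ler_pdivrMr// -mulrA ler_pM2l// expr2 ler_pM2l//.
by rewrite lerDr.
Qed.

(** One step, before taking expectations.  The right-hand side is linear in
    z and z^2 apart from the tail weights, so a mean and a variance suffice to
    integrate it: truncation shifts z by at most z^2 / sqrt m, and the quartic
    term and the truncation event together cost at most
    3 min (z^4 / m^2, 1). *)
Lemma lyapunov_pointwise m s z : (0 < m)%N ->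
  (s + truncate m z) ^+ 4 / quartic_scale m.+1 + (m%:R < z ^+ 2)%R%:R
    + 3 * tail_weight m (z ^+ 2)
  <= (s ^+ 4 + 4 * s ^+ 3 * z
      + (4 * `|s| ^+ 3 / Num.sqrt m%:R + 8 * s ^+ 2) * z ^+ 2) / quartic_scale m.+1
    + 3 * tail_weight m.-1 (z ^+ 2).
Proof.
move=> m_gt0; have a0 : 0 <= z ^+ 2 by rewrite sqr_ge0.
have := tail_weight_step m.-1 (z ^+ 2) a0; rewrite prednK//.
have := quartic_scale_ge m.+1 isT.
move: (tail_weight m _) (tail_weight m.-1 _) => w w'.
have M0 : 0 < m%:R :> R by rewrite ltr0n.
have M1 : m%:R <= m.+1%:R :> R by rewrite ler_nat.
move: (quartic_scale m.+1) => g gm.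
have gm2 : m%:R ^+ 2 <= g by apply: le_trans gm; rewrite lerXn2r ?nnegrE.
have g0 : 0 < g by apply: lt_le_trans gm2; rewrite exprn_gt0.
have q0 : 0 < Num.sqrt m%:R :> R by rewrite sqrtr_gt0.
have s3 : 0 <= 4 * `|s| ^+ 3 / Num.sqrt m%:R * z ^+ 2.
  by rewrite mulr_ge0// divr_ge0 ?ltW// mulr_ge0// exprn_ge0.
rewrite /truncate; case: (leP (z ^+ 2)) => am Hw /=.
  rewrite addr0.
  have Hz : (z ^+ 2) ^+ 2 / g <= (z ^+ 2) ^+ 2 / m%:R ^+ 2.
    by rewrite ler_wpM2l ?sqr_ge0// lef_pV2 ?posrE// exprn_gt0.
  suff : (s + z) ^+ 4 / g <= (s ^+ 4 + 4 * s ^+ 3 * z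
      + (4 * `|s| ^+ 3 / Num.sqrt m%:R + 8 * s ^+ 2) * z ^+ 2) / g
      + 3 * ((z ^+ 2) ^+ 2 / g) by lra.
  rewrite mulrA -mulrDl ler_pM2r ?invr_gt0//.
  have := sqr_ge0 (z * (s - z)); nra.
rewrite addr0.
have Hs : 0 <= 4 * s ^+ 3 * z + 4 * `|s| ^+ 3 / Num.sqrt m%:R * z ^+ 2.
  have za : `|z| <= z ^+ 2 / Num.sqrt m%:R.
    rewrite ler_pdivlMr// -[leRHS]real_normK ?num_real// expr2 ler_wpM2l//.
    by rewrite -sqrtr_sqr ler_wsqrtr// ltW.
  have := lerNnormlW (lexx `|s ^+ 3 * z|).
  rewrite normrM normrX => H1.
  have : `|s| ^+ 3 * `|z| <= `|s| ^+ 3 * (z ^+ 2 / Num.sqrt m%:R).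
    by rewrite ler_wpM2l// exprn_ge0.
  lra.
suff : s ^+ 4 / g <= (s ^+ 4 + 4 * s ^+ 3 * z
    + (4 * `|s| ^+ 3 / Num.sqrt m%:R + 8 * s ^+ 2) * z ^+ 2) / g by lra.
rewrite ler_pM2r ?invr_gt0//.
have : 0 <= s ^+ 2 * z ^+ 2 by rewrite mulr_ge0// sqr_ge0.
lra.
Qed.

End lyapunov_scale.

Section centered.
Context {R : realType} (nu : probability (measurableTypeR R) R) (mu : R).
Hypothesis mean_nu : ('E_nu[fun y => y] = mu%:E)%E.
Hypothesis var_nu : ('V_nu[fun y => y] < +oo)%E.

Definition second_moment : R := \int[nu]_y (y - mu) ^+ 2.

Definition tail_mean n : R := \int[nu]_y tail_weight n ((y - mu) ^+ 2).

Let mz : measurable_fun [set: measurableTypeR R] (fun y => y - mu).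
Proof. exact: measurable_funB. Qed.

Let mz2 : measurable_fun [set: measurableTypeR R] (fun y => (y - mu) ^+ 2).
Proof. exact: measurable_funX. Qed.

Let iz2 : nu.-integrable setT (EFin \o (fun y => (y - mu) ^+ 2)).
Proof.
apply/integrableP; split; first exact/measurable_EFinP.
move: var_nu; rewrite /variance covariance.unlock mean_nu expectation.unlock /=.
congr (_ < _)%E; apply: eq_integral => y _ /=.
by rewrite ger0_norm ?sqr_ge0// expr2.
Qed.

Let Rint_cst (r : R) : \int[nu]_y r = r.
Proof. by rewrite Rintegral_cst//= probability_setT mulr1. Qed.

Let icst (r : R) : nu.-integrable setT (EFin \o (fun=> r)).
Proof. exact: finite_measure_integrable_cst. Qed.

Let iD (f g : measurableTypeR R -> R) : nu.-integrable setT (EFin \o f) ->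
  nu.-integrable setT (EFin \o g) -> nu.-integrable setT (EFin \o (fun y => f y + g y)).
Proof. by move=> jf jg; exact: (integrableD measurableT jf jg). Qed.

Let iZ (k : R) (f : measurableTypeR R -> R) : nu.-integrable setT (EFin \o f) ->
  nu.-integrable setT (EFin \o (fun y => k * f y)).
Proof. by move=> jf; exact: (integrableZl measurableT k jf). Qed.

Let ile (f g : measurableTypeR R -> R) : measurable_fun setT f ->
  (forall y, `|f y| <= g y) -> nu.-integrable setT (EFin \o g) ->
  nu.-integrable setT (EFin \o f).
Proof.
move=> mf fg; apply: le_integrable => //; first exact/measurable_EFinP.
by move=> y _ /=; rewrite lee_fin (le_trans (fg y))// ler_norm.
Qed.

Let iz : nu.-integrable setT (EFin \o (fun y => y - mu)).
Proof.
apply: (ile _ (fun y => 1 + (y - mu) ^+ 2)) => //; last exact: iD.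
move=> y; have h1 := sqr_ge0 (y - mu + 1); have h2 := sqr_ge0 (y - mu - 1).
by rewrite ler_norml; apply/andP; split; nra.
Qed.

Let int_z : \int[nu]_y (y - mu) = 0.
Proof.
have iy : nu.-integrable setT (EFin \o (fun y => y)).
  have -> : (fun y => y) = (fun y : measurableTypeR R => (y - mu) + mu).
    by apply/funext => y; rewrite subrK.
  exact: iD.
rewrite RintegralB// Rint_cst.
by move: mean_nu; rewrite expectation.unlock /Rintegral /= => ->; rewrite subrr.
Qed.

Let mtw n : measurable_fun [set: measurableTypeR R] (fun y => tail_weight n ((y - mu) ^+ 2)).
Proof.
rewrite /tail_weight; apply: measurable_funM.
  by apply: measurable_funM => //; exact: measurable_funX.
rewrite (_ : (fun y => _) = (fun y => (n%:R + (y - mu) ^+ 2) `^ (-1))).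
  have h : measurable_fun [set: measurableTypeR R] (fun y => n%:R + (y - mu) ^+ 2).
    exact: measurable_funD.
  exact: (measurableT_comp (measurable_powR (-1)) h).
by apply/funext => y; rewrite powR_inv1// addr_ge0// sqr_ge0.
Qed.

Let itw n : nu.-integrable setT (EFin \o (fun y => tail_weight n ((y - mu) ^+ 2))).
Proof.
apply: (ile _ (fun y => 4 * (y - mu) ^+ 2)) => //; last exact: iZ.
by move=> y; have /andP[h0 h1] := tail_weight_le n ((y - mu) ^+ 2) (sqr_ge0 _);
  rewrite ger0_norm.
Qed.

Lemma second_moment_ge0 : 0 <= second_moment.
Proof. by apply: Rintegral_ge0 => y _; exact: sqr_ge0. Qed.

Lemma tail_mean_ge0 n : 0 <= tail_mean n.
Proof.
by apply: Rintegral_ge0 => y _; have /andP[] := tail_weight_le n ((y - mu) ^+ 2) (sqr_ge0 _).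
Qed.

Lemma measurable_truncate m : measurable_fun [set: R] (truncate m : R -> R).
Proof.
apply: measurable_fun_ifT => //.
by apply: measurable_fun_ler => //; exact: measurable_funX.
Qed.

Let Cst := (2 * second_moment ^+ 2 + 4 * second_moment) ^+ 2.

(** The deterministic part of the supermartingale: an upper bound on all the
    drift that can still be added after m - 1 pulls. *)
Definition budget m : R := 2 * Cst / sqrt_log m + 3 * tail_mean m.-1.

Lemma budget_ge0 m : 0 <= budget m.
Proof.
apply: addr_ge0; last by rewrite mulr_ge0// tail_mean_ge0.
by rewrite divr_ge0 ?sqrtr_ge0// mulr_ge0// sqr_ge0.
Qed.

(** When the arm is about to be pulled for the m-th time with current sum s,
    the expected increase of the normalized fourth power and of the number of
    truncations is paid by the budget: integrate [lyapunov_pointwise] and apply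
    [drift_dominates]. *)
Lemma lyapunov_step m s : (0 < m)%N ->
  (\int[nu]_y ((s + truncate m (y - mu)) ^+ 4 / quartic_scale m.+1
               + (m%:R < (y - mu) ^+ 2)%R%:R)%:E
    <= (s ^+ 4 / quartic_scale m + budget m - budget m.+1)%:E)%E.
Proof.
move=> m0; have v0 := second_moment_ge0.
set f := fun y : measurableTypeR R => (s + truncate m (y - mu)) ^+ 4 / quartic_scale m.+1
  + (m%:R < (y - mu) ^+ 2)%R%:R.
have sc0 k : 0 <= (quartic_scale k : R) by rewrite mulr_ge0 ?sqr_ge0// exprn_ge0// sqrtr_ge0.
have f0 y : 0 <= f y.
  by rewrite addr_ge0// divr_ge0// exprn_even_ge0.
have mf : measurable_fun setT f.
  apply: measurable_funD.
    apply: measurable_funM => //; apply: measurable_funX.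
    apply: measurable_funD => //.
    by apply: measurableT_comp => //; exact: measurable_truncate.
  rewrite (_ : (fun y => _) = (fun y => if m%:R < (y - mu) ^+ 2 then 1 else 0)); last first.
    by apply/funext => y; case: ifP.
  by apply: measurable_fun_ifT => //; exact: measurable_fun_ltr.
pose c := 4 * `|s| ^+ 3 / Num.sqrt m%:R + 8 * s ^+ 2.
pose g (y : measurableTypeR R) :=
  (s ^+ 4 + 4 * s ^+ 3 * (y - mu) + c * (y - mu) ^+ 2) / quartic_scale m.+1.
pose w n (y : measurableTypeR R) := tail_weight n ((y - mu) ^+ 2) : R.
have gE : g = (fun y => (quartic_scale m.+1)^-1 *
    (s ^+ 4 + 4 * s ^+ 3 * (y - mu) + c * (y - mu) ^+ 2)).
  by apply/funext => y; rewrite /g mulrC.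
have ig1 : nu.-integrable setT (EFin \o (fun y => s ^+ 4 + 4 * s ^+ 3 * (y - mu))).
  by apply: iD => //; exact: iZ.
have ig2 : nu.-integrable setT (EFin \o (fun y => c * (y - mu) ^+ 2)) by exact: iZ.
have ig : nu.-integrable setT (EFin \o g) by rewrite gE; apply: iZ; exact: iD.
have w0 n y : 0 <= w n y by have /andP[] := tail_weight_le n ((y - mu) ^+ 2) (sqr_ge0 _).
have fg y : f y + 3 * w m y <= g y + 3 * w m.-1 y by exact: lyapunov_pointwise.
have iw n : nu.-integrable setT (EFin \o (fun y => 3 * w n y)).
  exact: (iZ 3 (w n) (itw n)).
have if_ : nu.-integrable setT (EFin \o f).
  apply: (ile _ (fun y => g y + 3 * w m.-1 y)) => //; last exact: iD.
  by move=> y; rewrite ger0_norm//; have := fg y; have := w0 m y; lra.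
have -> : (\int[nu]_y (f y)%:E = (\int[nu]_y f y)%:E)%E.
  by rewrite fineK//; exact: integrable_fin_num.
rewrite lee_fin.
have : \int[nu]_y (f y + 3 * w m y) <= \int[nu]_y (g y + 3 * w m.-1 y).
  by apply: le_Rintegral => //; exact: iD.
have intD (h : measurableTypeR R -> R) n : nu.-integrable setT (EFin \o h) ->
    \int[nu]_y (h y + 3 * w n y) = \int[nu]_y h y + 3 * tail_mean n.
  move=> ih; rewrite (RintegralD measurableT ih (iw n)); congr (_ + _).
  exact: (RintegralZl 3 measurableT (itw n)).
rewrite !intD//.
have -> : \int[nu]_y g y = (s ^+ 4 + c * second_moment) / quartic_scale m.+1.
  rewrite gE RintegralZl//; last exact: iD.
  rewrite RintegralD//; rewrite RintegralD//; last exact: iZ.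
  rewrite !RintegralZl// int_z mulr0 addr0 Rint_cst.
  by rewrite mulrC.
have := drift_dominates second_moment s m v0 m0.
rewrite /budget -/Cst -/c /=.
lra.
Qed.

End centered.

(** * The history of an arm *)

Section history.
Context {d : measure_display} {Omega : measurableType d} {R : realType} {K : nat}.
Variables (X : nat -> Omega -> 'I_K) (Y : nat -> Omega -> R).
Hypothesis X_measurable : forall t j, measurable (X t @^-1` [set j]).
Hypothesis Y_measurable : forall t, measurable_fun setT (Y t).

Local Notation data t := (data_events X Y t).
Local Notation data_arm t := (data_events X Y t `|` arm_events X t).

Let arm_measurable t : arm_events X t `<=` measurable.
Proof. by move=> _ [j _ <-]; exact: X_measurable. Qed.

Let data_events_measurable t : data t `<=` measurable.
Proof.
move=> A [i _ [/arm_measurable//|[B mB <-]]].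
by rewrite -[X in measurable X]setTI; exact: Y_measurable.
Qed.

Let sigma_sub (G : set (set Omega)) : G `<=` measurable -> <<s G >> `<=` measurable.
Proof. by apply: smallest_sub; exact: sigma_algebra_measurable. Qed.

Lemma data_measurable t : <<s data t >> `<=` measurable.
Proof. exact: sigma_sub (@data_events_measurable t). Qed.

Lemma data_arm_measurable t : <<s data_arm t >> `<=` measurable.
Proof.
by apply: sigma_sub => A [/data_events_measurable//|/arm_measurable].
Qed.

Lemma data_sub_data_arm t : <<s data t >> `<=` <<s data_arm t >>.
Proof. by apply: sub_sigma_algebra2 => A; left. Qed.

Let data_le s t : (s <= t)%N -> data s `<=` data t.
Proof. by move=> st A [i /= si H]; exists i => //=; exact: leq_trans st. Qed.

Lemma data_arm_sub_data t : <<s data_arm t >> `<=` <<s data t.+1 >>.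
Proof.
apply: sub_sigma_algebra2 => A [/(data_le _ _ (leqnSn t))//|H].
by exists t => //=; left.
Qed.

Lemma data_increasing t : <<s data t >> `<=` <<s data t.+1 >>.
Proof. by apply: sub_sigma_algebra2; exact: data_le. Qed.

Lemma data_arm_event t k : <<s data_arm t >> (X t @^-1` [set k]).
Proof. by apply: sub_sigma_algebra; right; exists k. Qed.

Lemma data_arm_eq t s k : (s < t)%N ->
  measurable_fun [set: g_sigma_algebraType (data t)] (fun w => X s w == k).
Proof.
move=> st; apply: (measurable_fun_bool true); rewrite setTI.
rewrite (_ : _ @^-1` _ = X s @^-1` [set k]); last first.
  by apply/seteqP; split => w /= /eqP.
by apply: sub_sigma_algebra; exists s => //=; left; exists k.
Qed.

Lemma data_feedback t s : (s < t)%N ->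
  measurable_fun [set: g_sigma_algebraType (data t)] (Y s).
Proof.
move=> st _ B mB; rewrite setTI; apply: sub_sigma_algebra.
by exists s => //=; right; exists B.
Qed.

Variables (k : 'I_K) (m : R).

Definition pulls t w : nat := \sum_(s < t) (X s w == k).

Definition deviation t w : R :=
  \sum_(s < t) (if X s w == k then Y s w - m else 0).

(** The truncation level of a reward is known before it is drawn: it is the
    square root of the index of the pull among those of arm k. *)
Definition truncated_deviation t w : R :=
  \sum_(s < t) (if X s w == k then truncate (pulls s w).+1 (Y s w - m) else 0).

Definition exceedances t w : nat := \sum_(s < t)
  ((X s w == k) && ((pulls s w).+1%:R < (Y s w - m) ^+ 2)%R).

Let nat_fun_measurable {d2} {T2 : measurableType d2} (f : nat -> T2) : measurable_fun setT f.
Proof. by move=> _ B mB. Qed.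

Lemma measurable_pulls s t : (s <= t)%N ->
  measurable_fun [set: g_sigma_algebraType (data t)] (pulls s).
Proof.
elim: s => [_|s IH st].
  by rewrite (_ : pulls 0 = cst 0%N)//; apply/funext => w; rewrite /pulls big_ord0.
rewrite (_ : pulls s.+1 =
    fun w => if X s w == k then (pulls s w).+1 else pulls s w); last first.
  by apply/funext => w; rewrite /pulls big_ord_recr /=; case: eqP; rewrite ?addn1 ?addn0.
apply: measurable_fun_ifT; first exact: data_arm_eq.
  by apply: (measurableT_comp (nat_fun_measurable S)); exact: IH (ltnW st).
exact: IH (ltnW st).
Qed.

Let measurable_pullsR {d2} {T2 : measurableType d2} (f : nat -> T2) s t : (s <= t)%N ->
  measurable_fun [set: g_sigma_algebraType (data t)] (fun w => f (pulls s w)).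
Proof.
by move=> st; apply: (measurableT_comp (nat_fun_measurable f)); exact: measurable_pulls.
Qed.

Let measurable_noise s t : (s < t)%N ->
  measurable_fun [set: g_sigma_algebraType (data t)] (fun w => Y s w - m).
Proof. by move=> st; apply: measurable_funB => //; exact: data_feedback. Qed.

Let measurable_small s t : (s < t)%N ->
  measurable_fun [set: g_sigma_algebraType (data t)]
    (fun w => (Y s w - m) ^+ 2 <= (pulls s w).+1%:R).
Proof.
move=> st; apply: measurable_fun_ler.
  by apply: measurable_funX; exact: measurable_noise.
exact: (measurable_pullsR (fun n => n.+1%:R : R)) (ltnW st).
Qed.

Lemma measurable_truncated_deviation t :
  measurable_fun [set: g_sigma_algebraType (data t)] (truncated_deviation t).
Proof.
apply: measurable_sum => s; apply: measurable_fun_ifT => //; first exact: data_arm_eq.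
apply: measurable_fun_ifT => //; first exact: measurable_small.
exact: measurable_noise.
Qed.

Lemma measurable_exceedances t :
  measurable_fun [set: g_sigma_algebraType (data t)] (fun w => (exceedances t w)%:R : R).
Proof.
rewrite (_ : (fun w => _) = fun w => \sum_(s < t)
   (if X s w == k then if (Y s w - m) ^+ 2 <= (pulls s w).+1%:R then 0 else 1 else 0)).
  apply: measurable_sum => s; apply: measurable_fun_ifT => //; first exact: data_arm_eq.
  by apply: measurable_fun_ifT => //; exact: measurable_small.
apply/funext => w; rewrite /exceedances natr_sum; apply: eq_bigr => s _.
by case: eqP => //= _; case: leP.
Qed.

Lemma deviation_gap_bounded_before t w : exists D, forall s, (s <= t)%N ->
  `|deviation s w - truncated_deviation s w| <= D.
Proof.
exists (\sum_(s < t.+1) `|deviation s w - truncated_deviation s w|) => s st.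
rewrite (bigD1 (Ordinal (st : (s < t.+1)%N))) //=.
by rewrite lerDl sumr_ge0.
Qed.

(** Finitely many truncations change the sum only finitely often. *)
Lemma deviation_near_truncated w : (exists M : nat, forall t, (exceedances t w <= M)%N) ->
  exists D, forall t, `|deviation t w - truncated_deviation t w| <= D.
Proof.
move=> [M HM].
have mono s t : (s <= t)%N -> (exceedances s w <= exceedances t w)%N.
  elim: t => [|t IH]; first by rewrite leqn0 => /eqP->.
  rewrite leq_eqVlt => /orP[/eqP->//|/IH /leq_trans]; apply.
  by rewrite /exceedances big_ord_recr leq_addr.
have : exists T, forall t, (T <= t)%N -> exceedances t w = exceedances T w.
  apply: contrapT => H.
  have {}H n : exists t, (n <= exceedances t w)%N.
    elim: n => [|n [t Ht]]; first by exists 0%N.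
    apply: contrapT => H2; apply: H; exists t => u tu.
    have leu : (exceedances t w <= exceedances u w)%N by exact: mono.
    apply/eqP; rewrite eqn_leq leu andbT leqNgt; apply/negP => lt.
    by apply: H2; exists u; exact: leq_trans lt.
  by have [t] := H M.+1; rewrite ltnNge HM.
move=> [T HT]; have [D HD] := deviation_gap_bounded_before T w.
exists D => t; have [tT|Tt] := leqP t T; first exact: HD.
suff -> : deviation t w - truncated_deviation t w
    = deviation T w - truncated_deviation T w by exact: HD.
elim: t Tt => // t IH; rewrite ltnS leq_eqVlt => Tt.
have -> : deviation t.+1 w - truncated_deviation t.+1 w
    = deviation t w - truncated_deviation t w.
  have Tt' : (T <= t)%N by case/orP: Tt => [/eqP->//|/ltnW].
  have : exceedances t.+1 w = exceedances t w by rewrite !HT // ltnW.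
  rewrite /exceedances /deviation /truncated_deviation !big_ord_recr /=.
  case: eqP => [_|_ _] /=; last by rewrite !addr0.
  rewrite /truncate; case: ltP => [_|_ _]; last by ring.
  by move=> /eqP; rewrite -[X in _ == X]addn0 eqn_add2l.
by case/orP: Tt => [/eqP->//|/IH].
Qed.

End history.

(** * Almost sure growth of the centered reward sums *)

Section deviation_bound.
Context {d : measure_display} {Omega : measurableType d} {R : realType} {K : nat}.
Variables (P : probability Omega R).
Variables (X : nat -> Omega -> 'I_K) (Y : nat -> Omega -> R).
Hypothesis X_measurable : forall t j, measurable (X t @^-1` [set j]).
Hypothesis Y_measurable : forall t, measurable_fun setT (Y t).
Variable nu : 'I_K -> probability (measurableTypeR R) R.
Hypothesis feedback_law : bandit_feedback P nu X Y.
Variables (k : 'I_K) (mu : R).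
Hypothesis mean_nu : ('E_(nu k)[fun y => y] = mu%:E)%E.
Hypothesis var_nu : ('V_(nu k)[fun y => y] < +oo)%E.

Local Notation data t := (data_events X Y t).
Local Notation data_arm t := (data_events X Y t `|` arm_events X t).
Local Notation n_ t w := (pulls X k t w).
Local Notation s_ t w := (truncated_deviation X Y k mu t w).
Local Notation e_ t w := (exceedances X Y k mu t w).

Definition energy t w : R :=
  s_ t w ^+ 4 / quartic_scale (n_ t w).+1 + (e_ t w)%:R + budget (nu k) mu (n_ t w).+1.

Let scale_ge0 m : 0 <= (quartic_scale m : R).
Proof. by rewrite mulr_ge0 ?sqr_ge0// exprn_ge0// sqrtr_ge0. Qed.

Lemma energy_ge0 t w : 0 <= energy t w.
Proof.
apply: addr_ge0; last exact: budget_ge0.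
by rewrite addr_ge0// divr_ge0// exprn_even_ge0.
Qed.

Let mpulls t (f : nat -> R) :
  measurable_fun [set: g_sigma_algebraType (data t)] (fun w => f (n_ t w)).
Proof.
move=> mT B _.
exact: (measurable_pulls X Y k t t (leqnn t) mT (f @^-1` B) Logic.I).
Qed.

Lemma measurable_energy t :
  measurable_fun [set: g_sigma_algebraType (data t)] (energy t).
Proof.
apply: measurable_funD; last exact: (mpulls t (fun n => budget (nu k) mu n.+1)).
apply: measurable_funD; last exact: measurable_exceedances.
apply: measurable_funM; last exact: (mpulls t (fun n => (quartic_scale n.+1)^-1)).
by apply: measurable_funX; exact: measurable_truncated_deviation.
Qed.

(** On the event that arm k is pulled, the reward is independent of the data
    and has law nu k. *)
Let feedback_independent t C B :
  <<s data_arm t >> C -> measurable B -> C `<=` X t @^-1` [set k] ->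
  P (C `&` Y t @^-1` B) = (P C * nu k B)%E.
Proof.
move=> GC mB CX; have [_ _ /(_ _ GC)] := feedback_law t B mB.
rewrite setIC => <-.
rewrite (eq_integral (cst (nu k B))).
  by rewrite integral_cst 1?muleC//; exact: data_arm_measurable GC.
by move=> w /[!inE] /CX /= ->.
Qed.

(** When arm k is pulled, the reward is integrated out with the rest of the
    history frozen, which reduces the claim to [lyapunov_step]. *)
Let energy_step t C : <<s data_arm t >> C -> C `<=` X t @^-1` [set k] ->
  (\int[P]_(w in C) (energy t.+1 w)%:E <= \int[P]_(w in C) (energy t w)%:E)%E.
Proof.
move=> GC CX.
have mC : measurable C by exact: data_arm_measurable GC.
pose f (w : Omega) (y : R) : R :=
  (s_ t w + truncate (n_ t w).+1 (y - mu)) ^+ 4 / quartic_scale (n_ t w).+2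
  + ((n_ t w).+1%:R < (y - mu) ^+ 2)%R%:R.
pose c (w : Omega) : R := (e_ t w)%:R + budget (nu k) mu (n_ t w).+2.
have f0 w y : 0 <= f w y by rewrite addr_ge0// divr_ge0// exprn_even_ge0.
have c0 w : 0 <= c w by rewrite addr_ge0// budget_ge0.
pose F (z : g_sigma_algebraType (data_arm t) * measurableTypeR R) : \bar R :=
  (f z.1 z.2 + c z.1)%:E.
have m1 (h : Omega -> R) : measurable_fun [set: g_sigma_algebraType (data t)] h ->
    measurable_fun [set: g_sigma_algebraType (data_arm t) * measurableTypeR R]
      (fun z => h z.1).
  move=> mh.
  have mh' := sigma_measurable_fun_le _ _ _ (data_sub_data_arm X Y t) mh.
  exact: (measurableT_comp mh' measurable_fst).
have m2 : measurable_fun [set: g_sigma_algebraType (data_arm t) * measurableTypeR R]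
    (fun z => z.2 - mu : R).
  by apply: measurable_funB => //; exact: measurable_snd.
have mn (h : nat -> R) := m1 _ (mpulls t h).
have mf : measurable_fun [set: g_sigma_algebraType (data_arm t) * measurableTypeR R]
    (fun z => f z.1 z.2).
  apply: measurable_funD; last first.
    rewrite (_ : (fun z => _) =
      (fun z => if (n_ t z.1).+1%:R < (z.2 - mu) ^+ 2 then 1 else 0)); last first.
      by apply/funext => z; case: ifP.
    apply: measurable_fun_ifT => //; apply: measurable_fun_ltr.
      exact: (mn (fun n => n.+1%:R)).
    exact: measurable_funX.
  apply: measurable_funM; last exact: (mn (fun n => (quartic_scale n.+2)^-1)).
  apply: measurable_funX; apply: measurable_funD.
    by apply: m1; exact: measurable_truncated_deviation.
  apply: measurable_fun_ifT => //; apply: measurable_fun_ler.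
    exact: measurable_funX.
  exact: (mn (fun n => n.+1%:R)).
have mF : measurable_fun setT F.
  apply/measurable_EFinP; apply: measurable_funD => //.
  apply: measurable_funD; last exact: (mn (fun n => budget (nu k) mu n.+2)).
  by apply: (m1 (fun w => (e_ t w)%:R)); exact: measurable_exceedances.
have F0 z : (0 <= F z)%E by rewrite lee_fin addr_ge0.
rewrite (eq_integral (fun w => F (w, Y t w))); last first.
  move=> w /[!inE] /CX /= Xk; congr EFin.
  rewrite /energy /f /c /truncated_deviation /exceedances /pulls !big_ord_recr /= Xk eqxx /=.
  by rewrite addn1 natrD; ring.
rewrite (integral_independent P _ (data_arm_measurable X Y X_measurable Y_measurable t)
  _ mC (Y t : Omega -> measurableTypeR R) (nu k) F)//.
- apply: ge0_le_integral => //.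
  + by move=> w _; exact: integral_ge0.
  + have : measurable_fun [set: g_sigma_algebraType (data_arm t)]
        (fun w => \int[nu k]_y F (w, y))%E.
      exact: measurable_fun_fubini_tonelli_F.
    move=> /(sub_sigma_measurable_fun _ _
      (data_arm_measurable X Y X_measurable Y_measurable t)) mI.
    exact: measurable_funS mI.
  + apply/measurable_EFinP.
    have := sub_sigma_measurable_fun _ _
      (data_measurable X Y X_measurable Y_measurable t) (measurable_energy t).
    exact: measurable_funS.
  + move=> w _.
    have -> : (\int[nu k]_y F (w, y) = \int[nu k]_y (f w y)%:E + (c w)%:E)%E.
      rewrite (eq_integral (fun y : measurableTypeR R => (f w y)%:E + (c w)%:E)%E)//.
      rewrite ge0_integralD//.
      - by rewrite integral_cst//= probability_setT mule1.
      - by move=> y _; rewrite lee_fin.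
      - by apply/measurable_EFinP; exact: (measurableT_comp mf 
          (pair1_measurable (w : g_sigma_algebraType (data_arm t)))).
      - by move=> y _; rewrite lee_fin.
    have := lyapunov_step (nu k) mu mean_nu var_nu (n_ t w).+1 (s_ t w) isT.
    move=> /(leeD2r (c w)%:E) /le_trans; apply.
    rewrite -EFinD lee_fin /c /energy; lra.
- exact: (Y_measurable t).
- move=> C' B GC' mB; apply: feedback_independent => //.
  + by apply: (@measurableI _ (g_sigma_algebraType (data_arm t))).
  + by move=> w [_ /CX].
Qed.

Let energy_super t C : <<s data t >> C ->
  (\int[P]_(w in C) (energy t.+1 w)%:E <= \int[P]_(w in C) (energy t w)%:E)%E.
Proof.
move=> GC; have mC := data_measurable X Y X_measurable Y_measurable t _ GC.
have mX := X_measurable t k.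
have GaC := data_sub_data_arm X Y t _ GC.
have GaX := data_arm_event X Y t k.
rewrite -(setUIDK C (X t @^-1` [set k])).
have mU s D : measurable_fun D (fun w => (energy s w)%:E).
  apply/measurable_EFinP.
  have := sub_sigma_measurable_fun _ _
    (data_measurable X Y X_measurable Y_measurable s) (measurable_energy s).
  exact: measurable_funS.
have mI : measurable (C `&` X t @^-1` [set k]) by exact: measurableI.
have mD : measurable (C `\` X t @^-1` [set k]) by exact: measurableD.
have dj : [disjoint C `&` X t @^-1` [set k] & C `\` X t @^-1` [set k]].
  by apply/disj_set2P; apply/seteqP; split => // w [[_ ?] []].
have E0 s w : (0 <= (energy s w)%:E)%E by rewrite lee_fin energy_ge0.
rewrite !ge0_integral_setU//; apply: leeD.
  apply: energy_step; last exact: subIsetr.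
  exact: (@measurableI _ (g_sigma_algebraType (data_arm t))).
rewrite le_eqVlt; apply/orP; left; apply/eqP; apply: eq_integral => w /[!inE] -[_ /= Xk].
have {}Xk : (X t w == k) = false by apply/eqP.
rewrite /energy /truncated_deviation /exceedances /pulls !big_ord_recr /= Xk /=.
by rewrite !addn0 addr0.
Qed.

(** Boundedness of [energy] bounds both the truncated sum and the number of
    truncations, hence the sum itself. *)
Lemma deviation_bound : {ae P, forall w, exists M, forall t,
  deviation X Y k mu t w ^+ 4 <= M * quartic_scale (pulls X k t w).+1}.
Proof.
have E0 : (\int[P]_w (energy 0 w)%:E < +oo)%E.
  under eq_integral => w _ do
    rewrite /energy /truncated_deviation /exceedances /pulls !big_ord0 expr0n mul0r !add0r.
  by rewrite integral_cst//= probability_setT mule1 ltry.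
have := supermartingale_bounded P _ (data_increasing X Y)
  (data_measurable X Y X_measurable Y_measurable) _ energy_ge0 measurable_energy
  energy_super E0.
apply: filterS => w [M HM].
have scale1 n : 1 <= (quartic_scale n.+1 : R).
  by apply: le_trans (quartic_scale_ge n.+1 isT); rewrite exprn_ege1// ler1n.
have Ms t : s_ t w ^+ 4 <= M * quartic_scale (n_ t w).+1.
  rewrite -ler_pdivrMr; last exact: lt_le_trans (scale1 _).
  apply: le_trans (HM t); rewrite /energy -addrA lerDl addr_ge0//.
  exact: budget_ge0.
have Me t : (e_ t w <= Num.truncn M)%N.
  rewrite truncn_ge_nat; last exact: le_trans (energy_ge0 0 w) (HM 0%N).
  apply: le_trans (HM t); rewrite /energy addrAC lerDr addr_ge0 ?budget_ge0//.
  by rewrite divr_ge0// exprn_even_ge0.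
have [|D HD] := deviation_near_truncated X Y k mu w; first by exists (Num.truncn M).
exists (8 * (M + D ^+ 4)) => t.
set x := deviation _ _ _ _ _ _; have := HD t; rewrite -/x; have := Ms t.
have := scale1 (n_ t w).
move: (quartic_scale _) (s_ t w) => g s g1 Hs xs.
have h4 : (x - s) ^+ 4 <= D ^+ 4.
  have -> : (x - s) ^+ 4 = `|x - s| ^+ 4.
    by rewrite (_ : 4 = 2 * 2)%N// !exprM real_normK ?num_real.
  by rewrite lerXn2r ?nnegrE// (le_trans _ xs).
have h5 : x ^+ 4 <= 8 * (s ^+ 4 + (x - s) ^+ 4).
  move: (x - s) (subrK s x) => u <-.
  have := sqr_ge0 (u - s); have := sqr_ge0 (u + s); have := sqr_ge0 (u ^+ 2 - s ^+ 2).
  nra.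
have D0 : 0 <= D ^+ 4 by exact: exprn_even_ge0.
nra.
Qed.

End deviation_bound.

(** * Bounds on the posterior *)

Section posterior_bounds.
Context {R : realType} {K : nat}.
Implicit Types (D : seq ('I_K * R)) (v mu : 'I_K -> R) (k j : 'I_K).

Definition arm_count D k : R := \sum_(x <- D) (x.1 == k)%:R.
Definition arm_dev mu D k : R := \sum_(x <- D) (x.1 == k)%:R * (x.2 - mu k).
(** The maximum over all v of the log-likelihood ratio of v to mu. *)
Definition misfit mu D : R := 2^-1 * \sum_k arm_dev mu D k ^+ 2 / arm_count D k.

(** a w^2 + b w'^2 is at least parallel_sum a b * (w - w')^2. *)
Definition parallel_sum (a b : R) : R := a * b / (a + b).

Lemma arm_count_ge0 D k : 0 <= arm_count D k.
Proof. by apply: sumr_ge0. Qed.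

Lemma arm_dev0 mu D k : arm_count D k = 0 -> arm_dev mu D k = 0.
Proof.
move=> /eqP; rewrite psumr_eq0// => /allP H.
by rewrite /arm_dev big_seq big1// => x /H /eqP ->; rewrite mul0r.
Qed.

Lemma likelihood_gt0 D v : 0 < likelihood 1 D v.
Proof.
apply: prodr_gt0 => x _; rewrite normal_pdfE ?oner_eq0//=.
by rewrite mulr_gt0 ?expR_gt0// normal_peak_gt0 ?oner_eq0.
Qed.

(** The data enter only through the counts and the centered sums. *)
Lemma likelihood_ratio D v mu : likelihood 1 D v = likelihood 1 D mu *
  expR (- 2^-1 * \sum_k (arm_count D k * (v k - mu k) ^+ 2
                          - 2 * (v k - mu k) * arm_dev mu D k)).
Proof.
rewrite /likelihood; elim: D => [|x D IH].
  rewrite !big_nil big1 ?mulr0 ?expR0 ?mulr1// => k _.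
  by rewrite /arm_count /arm_dev !big_nil mul0r mulr0 subr0.
rewrite !big_cons {}IH.
have -> : normal_pdf (v x.1) 1 x.2 = normal_pdf (mu x.1) 1 x.2 *
    expR (- 2^-1 * ((v x.1 - mu x.1) ^+ 2 - 2 * (v x.1 - mu x.1) * (x.2 - mu x.1))).
  rewrite !normal_pdfE ?oner_eq0//= -[RHS]mulrA; congr (_ * _).
  rewrite /normal_fun -expRD; congr expR; by field.
rewrite mulrACA -expRD -mulrDr; congr (_ * expR (_ * _)).
rewrite (bigD1 x.1)//= [in RHS](bigD1 x.1)//= addrA; congr (_ + _).
  by rewrite /arm_count /arm_dev !big_cons eqxx /= mulr1n; ring.
apply: eq_bigr => k kx; rewrite /arm_count /arm_dev !big_cons eq_sym (negbTE kx).
by rewrite mul0r !add0r.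
Qed.

(** Completing the square after giving up a fraction eta of the quadratic
    term. *)
Let quad_lb D mu k eta x : 0 < eta ->
  (1 - eta) * (arm_count D k * x ^+ 2) - eta^-1 * (arm_dev mu D k ^+ 2 / arm_count D k)
  <= arm_count D k * x ^+ 2 - 2 * x * arm_dev mu D k.
Proof.
move=> eta0; have := arm_count_ge0 D k; rewrite le_eqVlt => /orP[/eqP N0|].
  by rewrite arm_dev0// -N0 expr0n/= !mul0r !mulr0 subrr.
move: (arm_count D k) (arm_dev mu D k) => N S N0.
have -> : eta^-1 * (S ^+ 2 / N) = S ^+ 2 / (eta * N) by field; rewrite !gt_eqF.
rewrite -subr_ge0.
have -> : N * x ^+ 2 - 2 * x * S - ((1 - eta) * (N * x ^+ 2) - S ^+ 2 / (eta * N))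
   = (eta * N * x - S) ^+ 2 / (eta * N) by field; rewrite !gt_eqF.
by rewrite divr_ge0 ?sqr_ge0// mulr_ge0 ?ltW.
Qed.

Lemma likelihood_le D mu v : likelihood 1 D v <= likelihood 1 D mu * expR (misfit mu D).
Proof.
rewrite (likelihood_ratio D v mu) ler_pM2l ?likelihood_gt0// ler_expR /misfit mulNr -mulrN.
rewrite ler_pM2l ?invr_gt0// -sumrN; apply: ler_sum => k _.
by have := quad_lb D mu k 1 (v k - mu k) ltr01; rewrite subrr mul0r invr1; lra.
Qed.

(** If v ranks j above i while mu ranks i above j, then v - mu has to bridge
    the gap mu i - mu j with the coordinates i and j alone, which costs
    parallel_sum times the squared gap. *)
Lemma likelihood_wrong_le D mu v j i eta : 0 < eta < 1 -> i != j ->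
  mu j <= mu i -> v i <= v j ->
  likelihood 1 D v <= likelihood 1 D mu *
    expR (misfit mu D / eta - 2^-1 * (1 - eta) *
            (parallel_sum (arm_count D j) (arm_count D i) * (mu i - mu j) ^+ 2)).
Proof.
move=> /andP[eta0 eta1] ij muij vij.
rewrite (likelihood_ratio D v mu) ler_pM2l ?likelihood_gt0// ler_expR /misfit.
have h1 : (1 - eta) * (\sum_k arm_count D k * (v k - mu k) ^+ 2)
    - eta^-1 * (\sum_k arm_dev mu D k ^+ 2 / arm_count D k)
   <= \sum_k (arm_count D k * (v k - mu k) ^+ 2 - 2 * (v k - mu k) * arm_dev mu D k).
  by rewrite !mulr_sumr -sumrB; apply: ler_sum => k _; exact: quad_lb.
have h2 : parallel_sum (arm_count D j) (arm_count D i) * (mu i - mu j) ^+ 2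
    <= \sum_k arm_count D k * (v k - mu k) ^+ 2.
  have nn k : 0 <= arm_count D k * (v k - mu k) ^+ 2.
    by rewrite mulr_ge0 ?sqr_ge0// arm_count_ge0.
  rewrite (bigD1 j)//= (bigD1 i)//= addrA; apply: ler_wpDr; first by apply: sumr_ge0.
  rewrite /parallel_sum; have := arm_count_ge0 D j; have := arm_count_ge0 D i.
  move: (arm_count D j) (arm_count D i) => a b b0 a0.
  have := addr_ge0 a0 b0; rewrite le_eqVlt => /orP[/eqP<-|ab0].
    by rewrite invr0 mulr0 mul0r addr_ge0// mulr_ge0// sqr_ge0.
  rewrite mulrAC ler_pdivrMr//.
  have : (mu i - mu j) ^+ 2 <= ((v j - mu j) - (v i - mu i)) ^+ 2.
    by rewrite lerXn2r ?nnegrE; lra.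
  move=> /(ler_wpM2l (mulr_ge0 a0 b0)) /le_trans; apply.
  have := sqr_ge0 (a * (v j - mu j) + b * (v i - mu i)); lra.
have : (1 - eta) * (parallel_sum (arm_count D j) (arm_count D i) * (mu i - mu j) ^+ 2)
   <= (1 - eta) * \sum_k arm_count D k * (v k - mu k) ^+ 2.
  by rewrite ler_wpM2l// subr_ge0 ltW.
rewrite [_ / eta]mulrC; lra.
Qed.

Variables (Theta : set ('I_K -> R)).
Local Notation prof D := (profile_likelihood 1 Theta D).
Local Notation post D := (posterior uniform_prior 1 Theta D).

Lemma profile_ge0 D k : 0 <= prof D k.
Proof.
rewrite /profile_likelihood; set A := _ @` _.
have [->|/set0P[x Ax]] := eqVneq A set0; first by rewrite sup0.
have [hs|nhs] := pselect (has_sup A); last by rewrite sup_out.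
have x0 : 0 <= x by case: Ax => v _ <-; exact: ltW (likelihood_gt0 D v).
by apply: le_trans x0 _; apply: ub_le_sup => //; case: hs.
Qed.

Lemma profile_le D k c : 0 <= c ->
  (forall v, optimal_params Theta k v -> likelihood 1 D v <= c) -> prof D k <= c.
Proof.
move=> c0 H; rewrite /profile_likelihood; set A := _ @` _.
have [->|/set0P nA] := eqVneq A set0; first by rewrite sup0.
by apply: ge_sup => // _ [v /H ? <-].
Qed.

Lemma profile_ge mu D k : optimal_params Theta k mu -> likelihood 1 D mu <= prof D k.
Proof.
move=> Hk; apply: ub_le_sup; last by exists mu.
by exists (likelihood 1 D mu * expR (misfit mu D)) => _ [v _ <-]; exact: likelihood_le.
Qed.

Lemma posterior_bounds D k : 0 <= post D k <= 1.
Proof.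
case: D => [|x D].
  have K0 : (0 < K)%N := leq_ltn_trans (leq0n k) (ltn_ord k).
  by rewrite /posterior /uniform_prior invr_ge0 ler0n invf_le1 ?ltr0n// ler1n.
rewrite /posterior; set w := fun k : 'I_K => prof (x :: D) k * uniform_prior k.
have w0 i : 0 <= w i by rewrite mulr_ge0 ?profile_ge0// invr_ge0.
rewrite -/(w k) -/(\sum_(i < K) w i).
apply/andP; split; first by rewrite divr_ge0// sumr_ge0.
have wk : w k <= \sum_(i < K) w i by rewrite (bigD1 k)//= lerDl sumr_ge0.
have : 0 <= \sum_(i < K) w i by apply: sumr_ge0.
rewrite le_eqVlt => /orP[/eqP<-|S0].
  by rewrite invr0 mulr0.
by rewrite ler_pdivrMr// mul1r.
Qed.

(** L(mu) competes for k, and no arm can exceed expR misfit * L(mu). *)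
Lemma posterior_optimal_ge mu D k : D != [::] -> optimal_params Theta k mu ->
  expR (- misfit mu D) / K%:R <= post D k.
Proof.
case: D => // x D _ Hk; set D' := x :: D.
have K0 : (0 < K)%N := leq_ltn_trans (leq0n k) (ltn_ord k).
have KR : 0 < K%:R :> R by rewrite ltr0n.
have Lk := profile_ge mu D' k Hk; have L0 := likelihood_gt0 D' mu.
rewrite /posterior -/D' /uniform_prior -mulr_suml invfM invrK.
have S0 : 0 < \sum_(i < K) prof D' i.
  rewrite (bigD1 k)//=; apply: ltr_wpDr; first by apply: sumr_ge0 => i _; exact: profile_ge0.
  exact: lt_le_trans Lk.
have SK : \sum_(i < K) prof D' i <= K%:R * (likelihood 1 D' mu * expR (misfit mu D')).
  rewrite -[X in X%:R * _]card_ord mulr_natl -sumr_const; apply: ler_sum => i _.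
  apply: profile_le; first by rewrite mulr_ge0 ?expR_ge0// ltW.
  by move=> v _; exact: likelihood_le.
have -> : prof D' k / K%:R * ((\sum_(i < K) prof D' i)^-1 * K%:R)
   = prof D' k / \sum_(i < K) prof D' i by field; rewrite !gt_eqF.
rewrite ler_pdivlMr//; apply: le_trans Lk.
apply: le_trans (ler_wpM2l _ SK) _; first by rewrite divr_ge0 ?expR_ge0// ltW.
rewrite expRN le_eqVlt; apply/orP; left; apply/eqP; field.
by rewrite !gt_eqF ?expR_gt0.
Qed.

Lemma posterior_wrong_le mu D i j eta : D != [::] -> 0 < eta < 1 ->
  optimal_params Theta i mu -> i != j ->
  post D j <= expR (misfit mu D / eta - 2^-1 * (1 - eta) *
            (parallel_sum (arm_count D j) (arm_count D i) * (mu i - mu j) ^+ 2)).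
Proof.
case: D => // x D _ eta01 Hi ij; set D' := x :: D.
have K0 : (0 < K)%N := leq_ltn_trans (leq0n i) (ltn_ord i).
have KR : 0 < K%:R :> R by rewrite ltr0n.
have Li := profile_ge mu D' i Hi; have L0 := likelihood_gt0 D' mu.
rewrite /posterior -/D' /uniform_prior -mulr_suml invfM invrK.
have Pi0 : 0 < prof D' i by exact: lt_le_trans Li.
have SS : prof D' i <= \sum_(i < K) prof D' i.
  by rewrite [leRHS](bigD1 i)//= lerDl; apply: sumr_ge0 => k _; exact: profile_ge0.
have S0 : 0 < \sum_(i < K) prof D' i by exact: lt_le_trans SS.
have -> : prof D' j / K%:R * ((\sum_(i < K) prof D' i)^-1 * K%:R)
   = prof D' j / \sum_(i < K) prof D' i by field; rewrite !gt_eqF.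
rewrite ler_pdivrMr//; set E := expR _.
have E0 : 0 <= E by exact: expR_ge0.
apply: (@le_trans _ _ (likelihood 1 D' mu * E)).
  apply: profile_le; first by rewrite mulr_ge0// ltW.
  move=> v [_ /(_ i) vij]; apply: likelihood_wrong_le => //.
  by have [_ /(_ j)] := Hi.
by rewrite mulrC; apply: ler_wpM2l => //; exact: le_trans SS.
Qed.

End posterior_bounds.

(** * Deterministic growth estimates *)

Section pathwise.
Context {R : realType}.

Lemma ln_eventually_ge (M : R) : exists T, forall t, (T <= t)%N -> M <= ln (t%:R : R).
Proof.
exists (Num.truncn (expR M)).+1 => t Tt.
have Mt : expR M < t%:R by apply: lt_le_trans (truncnS_gt _) _; rewrite ler_nat.
by rewrite -[leLHS]expRK ler_ln ?posrE ?expR_gt0 ?(lt_trans (expR_gt0 M) Mt)// ltW.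
Qed.

(** With r = sqrt (1 + ln (N + 1)), the hypothesis bounds (dev^2 / N)^2 by a
    multiple of r^3, whereas (ln t)^2 is at least of order r^4. *)
Lemma dev_sq_small (dev : nat -> R) (N : nat -> nat) (M : R) :
  (forall t, dev t ^+ 4 <= M * quartic_scale (N t).+1) -> (forall t, (N t <= t)%N) ->
  forall e, 0 < e -> exists T, forall t, (T <= t)%N ->
    dev t ^+ 2 / (N t)%:R <= e * ln (t%:R : R).
Proof.
move=> HM Nt e e0.
(* For ln t >= L^2, this L makes 4 M r^3 <= e^2 (ln t)^2. *)
pose L := Num.max 2 (16 * M / e ^+ 2).
have [T HT] := ln_eventually_ge (L ^+ 2); exists T.+1 => t Tt.
have t0 : (0 < t)%N by exact: leq_trans Tt.
have := HT t (ltnW Tt).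
have u0 : 0 <= ln (t%:R : R) by rewrite ln_ge0// ler1n.
have [/eqP|N0] := posnP (N t).
  by move=> /eqP -> _; rewrite invr0 mulr0 mulr_ge0// ltW.
have L2 : 2 <= L by rewrite /L le_max lexx.
have LM : 16 * M <= L * e ^+ 2.
  by rewrite -ler_pdivrMr ?exprn_gt0// /L le_max lexx orbT.
have r1 := sqrt_log_ge1 (R := R) (N t).+1 isT.
have r2 : sqrt_log (N t).+1 ^+ 2 <= 2 + ln (t%:R : R).
  rewrite sqrt_log_sq// (_ : 2 = 1 + 1 :> R)// -addrA lerD2l.
  apply: (@le_trans _ _ (ln (2 * t%:R))).
    rewrite ler_ln ?posrE ?mulr_gt0 ?ltr0n//.
    by rewrite -natrM ler_nat mulSn mul1n -addn1 leq_add.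
  rewrite lnM ?posrE ?ltr0n// lerD2r.
  by apply: le_trans (@le_ln1Dx R 1 _) => //; rewrite ltrN10 // ltr_pDl.
have M0 : 0 <= M.
  have : 0 <= M * quartic_scale (N t).+1 by apply: le_trans (HM t); exact: exprn_even_ge0.
  rewrite pmulr_lge0//; apply: lt_le_trans (quartic_scale_ge (N t).+1 isT).
  by rewrite exprn_gt0// ltr0n.
have H4 : (dev t ^+ 2 / (N t)%:R) ^+ 2 <= 4 * M * sqrt_log (N t).+1 ^+ 3.
  have NR : 1 <= (N t)%:R :> R by rewrite ler1n.
  have NR0 : 0 < (N t)%:R :> R by rewrite ltr0n.
  rewrite exprMn exprVn -exprM ler_pdivrMr ?exprn_gt0//.
  have := HM t; rewrite /quartic_scale -natr1.
  move/le_trans; apply.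
  have h : ((N t)%:R + 1) ^+ 2 <= 4 * (N t)%:R ^+ 2 :> R by nra.
  have s3 : 0 <= M * sqrt_log (N t).+1 ^+ 3 by rewrite mulr_ge0// exprn_ge0// sqrtr_ge0.
  by have := ler_wpM2r s3 h; lra.
move=> Lu; set x := _ / _ in H4 *.
move: (sqrt_log _) (ln _) u0 r1 r2 H4 Lu => r u u0 r1 r2 H4 Lu.
have u4 : 4 <= u by nra.
have r2u : r ^+ 2 <= 2 * u by lra.
have Mr : 8 * M * r <= e ^+ 2 * u.
  have h1 : 16 * M * r <= L * e ^+ 2 * r by rewrite ler_wpM2r//; lra.
  have h2 : L * r <= 3 / 2 * u by have := sqr_ge0 (L - r); lra.
  have h3 : e ^+ 2 * (L * r) <= e ^+ 2 * (3 / 2 * u) by rewrite ler_wpM2l ?sqr_ge0.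
  have h4 : 0 <= e ^+ 2 * u by rewrite mulr_ge0 ?sqr_ge0.
  lra.
have h5 : 4 * M * r * r ^+ 2 <= 4 * M * r * (2 * u).
  by rewrite ler_wpM2l// !mulr_ge0//; lra.
have h6 : 8 * M * r * u <= e ^+ 2 * u * u by rewrite ler_wpM2r.
rewrite -ler_sqr ?nnegrE; last 2 first.
- by rewrite /x divr_ge0 ?sqr_ge0.
- by rewrite mulr_ge0// ltW.
have -> : (e * u) ^+ 2 = e ^+ 2 * u * u by ring.
apply: le_trans H4 _; lra.
Qed.

(** If q_t >= k / sqrt t eventually, then the sum of q over s < t grows at
    least like sqrt t, hence like (ln t)^2. *)
Lemma compensator_superlog (q N : nat -> R) (k c M : R) :
  0 < k -> 0 < c -> (forall t, 0 <= q t) ->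
  (exists T, forall t, (T <= t)%N -> k * expR (- (2^-1 * ln t%:R)) <= q t) ->
  (forall t, c * \sum_(s < t) q s <= N t + M) ->
  forall C, exists T, forall t, (T <= t)%N -> C * ln t%:R <= N t.
Proof.
move=> k0 c0 q0 [T0 HT0] HN C.
pose g := c * k / 16; pose B := c * k * T0.+1%:R + `|M|.
have g0 : 0 < g by rewrite !mulr_gt0// invr_gt0.
have B0 : 0 <= B by rewrite addr_ge0// !mulr_ge0// ltW.
have [T HT] := ln_eventually_ge (Num.max 1 ((`|C| + B) / g)).
exists (maxn T T0.+1) => t; rewrite geq_max => /andP[/HT Tt T0t].
apply: le_trans (_ : g * ln t%:R ^+ 2 - B <= _).
  move: Tt; rewrite ge_max => /andP[u1]; rewrite ler_pdivrMr// => uC.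
  have := ler_norm C; move: (ln _) u1 uC => u u1 uC CC.
  have : (`|C| + B) * u <= u * g * u by rewrite ler_wpM2r//; lra.
  have : C * u <= `|C| * u by rewrite ler_wpM2r//; lra.
  have : B <= B * u by rewrite ler_peMr.
  lra.
have t0 : (0 < t)%N by exact: leq_trans T0t.
have tR : 0 < t%:R :> R by rewrite ltr0n.
have u0 : 0 <= ln (t%:R : R) by rewrite ln_ge0// ler1n.
pose E : R := expR (- (2^-1 * ln t%:R)).
have sumE : (t - T0.+1)%N%:R * (k * E) <= \sum_(s < t) q s.
  rewrite -[leRHS](big_mkord xpredT q) (big_cat_nat (leq0n T0.+1) T0t)/=.
  apply: ler_wpDl; first by apply: sumr_ge0.
  rewrite mulr_natl -sumr_const_nat; apply: ler_sum_nat => s /andP[Ts st].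
  apply: le_trans (HT0 s (ltnW Ts)); rewrite ler_pM2l// ler_expR lerN2.
  rewrite ler_pM2l ?invr_gt0// ler_ln ?posrE ?ltr0n//; last exact: leq_trans Ts.
  by rewrite ler_nat ltnW.
have E1 : E <= 1.
  by rewrite /E -[leRHS]expR0 ler_expR oppr_le0 mulr_ge0.
have tE : ln (t%:R : R) ^+ 2 / 16 <= t%:R * E.
  rewrite -[X in _ <= X * _](lnK (_ : t%:R \is Num.pos)) ?posrE// /E -expRD.
  have -> : ln t%:R + - (2^-1 * ln t%:R) = 4^-1 * ln t%:R + 4^-1 * ln t%:R :> R by field.
  have y0 : 0 <= 4^-1 * ln (t%:R : R) by rewrite mulr_ge0.
  have -> : ln (t%:R : R) ^+ 2 / 16 = (4^-1 * ln t%:R) * (4^-1 * ln t%:R) by field.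
  have H := expR_ge1Dx (4^-1 * ln (t%:R : R)).
  by rewrite expRD; apply: ler_pM => //; apply: le_trans H; rewrite lerDr.
have ck : 0 < c * k by rewrite mulr_gt0.
have := ler_wpM2l (ltW c0) sumE; have := HN t.
rewrite natrB//; have := ler_norm M.
have : c * k * (ln t%:R ^+ 2 / 16) <= c * k * (t%:R * E) by rewrite ler_pM2l.
have : c * k * T0.+1%:R * E <= c * k * T0.+1%:R * 1.
  by rewrite ler_wpM2l// mulr_ge0// ltW.
rewrite /g /B; lra.
Qed.

(** The sum of s^(-1-p) telescopes against s^(-p) / p. *)
Lemma sum_le_of_decay (f : nat -> R) (p : R) : 0 < p ->
  (forall t, 0 <= f t <= 1) ->
  (exists T, forall t, (T <= t)%N -> f t <= expR (- ((1 + p) * ln t%:R))) ->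
  exists B, forall t, \sum_(s < t) f s <= B.
Proof.
move=> p0 f01 [T HT].
(* Starting at 2 keeps the logarithm of the predecessor nonnegative. *)
pose T2 := maxn T 2; exists (T2%:R + p^-1) => t.
have triv n : \sum_(s < n) f s <= n%:R.
  rewrite -[n in leRHS]card_ord -sumr_const.
  by apply: ler_sum => s _; have /andP[] := f01 s.
have pp : 0 < p^-1 by rewrite invr_gt0.
have [tT|Tt] := leqP t T2.
  apply: le_trans (triv t) _; apply: ler_wpDr; first exact: ltW.
  by rewrite ler_nat.
pose e n : R := expR (- (p * ln n%:R)).
suff H n : \sum_(s < T2 + n) f s <= T2%:R + p^-1 * (1 - e (T2 + n).-1).
  rewrite -(subnKC (ltnW Tt)); apply: le_trans (H _) _.
  by rewrite lerD2l ler_piMr ?(ltW pp)// lerBlDr lerDl expR_ge0.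
elim: n => [|n IH].
  rewrite addn0; apply: le_trans (triv T2) _; rewrite lerDl mulr_ge0 ?(ltW pp)// subr_ge0.
  rewrite /e -[leRHS]expR0 ler_expR oppr_le0; apply: mulr_ge0; first exact: ltW.
  apply: ln_ge0. rewrite ler1n -ltnS prednK; first exact: leq_maxr.
  by rewrite leq_max orbT.
rewrite addnS big_ord_recr /=.
set m := (T2 + n)%N in IH *.
have m2 : (2 <= m)%N by rewrite /m /T2 ltn_addr// leq_max orbT.
have Tm : (T <= m)%N by rewrite /m /T2 (leq_trans (leq_maxl T 2))// leq_addr.
suff : f m <= p^-1 * (e m.-1 - e m) by move: IH; lra.
apply: le_trans (HT m Tm) _.
rewrite ler_pdivlMl// /e.
have m0 : (0 < m)%N by exact: ltnW m2.
have m1 : (0 < m.-1)%N by rewrite -ltnS prednK.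
have := lnS_sub_ln (R := R) m.-1 m1; rewrite prednK//.
have mR : 0 < m%:R :> R by rewrite ltr0n.
have -> : expR (- ((1 + p) * ln m%:R)) = m%:R^-1 * expR (- (p * ln m%:R)) :> R.
  by rewrite mulrDl mul1r opprD expRD (expRN (ln _)) lnK ?posrE.
have -> : expR (- (p * ln m.-1%:R))
    = expR (- (p * ln m%:R)) * expR (p * (ln m%:R - ln m.-1%:R)) :> R.
  by rewrite -expRD; congr expR; ring.
have := expR_ge1Dx (p * (ln m%:R - ln (m.-1%:R : R))).
have := expR_gt0 (- (p * ln (m%:R : R))).
set a := expR (- (p * ln m%:R)); set l := ln m%:R - ln m.-1%:R.
set b := expR (p * l); set i := m%:R^-1 => a0 H1 H2.
have H3 : p * i <= p * l by rewrite ler_pM2l.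
have : a * (1 + p * i) <= a * b by rewrite ler_pM2l//; lra.
lra.
Qed.

Lemma parallel_sum_le (a b a' b' : R) : 0 < a -> 0 < b -> a <= a' -> b <= b' ->
  parallel_sum a b <= parallel_sum a' b'.
Proof.
move=> a0 b0 aa bb; rewrite /parallel_sum ler_pdivrMr ?addr_gt0//.
have a0' : 0 < a' by exact: lt_le_trans aa.
have b0' : 0 < b' by exact: lt_le_trans bb.
rewrite mulrAC ler_pdivlMr ?addr_gt0//.
have h1 : a * a' * b <= a * a' * b' by rewrite ler_pM2l ?mulr_gt0.
have h2 : b * b' * a <= b * b' * a' by rewrite ler_pM2l ?mulr_gt0.
lra.
Qed.

(** The exponent of the bound on the sampling probability of a wrong arm, for
    u = ln t.  As C tends to infinity, parallel_sum a b tends to a; the choice of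
    C makes the loss turn 1 + e into 1 + e / 2, and the factor 1 - e / 8 and the
    misfit leave 1 + e / 8. *)
Lemma wrong_arm_exponent (e D : R) : 0 < e <= 1 -> 0 < D ->
  exists C, 0 < C /\ forall u a b A, 0 < u ->
    (1 + e) * (2 / D ^+ 2) * u <= a -> C * u <= b -> A <= e ^+ 2 / 64 * u ->
    A / (e / 8) - 2^-1 * (1 - e / 8) * (parallel_sum a b * D ^+ 2)
      <= - ((1 + e / 8) * u).
Proof.
move=> /andP[e0 e1] D0.
have D2 : 0 < D ^+ 2 by rewrite exprn_gt0.
pose g := 2 / D ^+ 2; have g0 : 0 < g by rewrite divr_gt0.
pose x := (1 + e) * g; pose y := (1 + e / 2) * g.
have x0 : 0 < x by rewrite mulr_gt0//; lra.
have y0 : 0 < y by rewrite mulr_gt0//; lra.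
have xy : 0 < x - y by rewrite -mulrBl mulr_gt0//; lra.
(* Chosen so that parallel_sum x C = y. *)
pose C := x * y / (x - y); have C0 : 0 < C by rewrite divr_gt0// mulr_gt0.
exists C; split => // u a b A u0 ha hb hA.
have hH : y * u <= parallel_sum a b.
  have -> : y * u = parallel_sum (x * u) (C * u).
    have xC : x + C = x ^+ 2 / (x - y) by rewrite /C; field; rewrite gt_eqF.
    by rewrite /parallel_sum -mulrDl xC /C; field; rewrite !gt_eqF.
  by apply: parallel_sum_le => //; rewrite mulr_gt0.
have h1 : 2 * (1 + e / 2) * u <= parallel_sum a b * D ^+ 2.
  have -> : 2 * (1 + e / 2) * u = y * u * D ^+ 2 by rewrite /y /g; field; rewrite gt_eqF.
  by rewrite ler_pM2r.
have h2 : A / (e / 8) <= e / 8 * u.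
  by rewrite ler_pdivrMr ?divr_gt0//; lra.
have h3 : 2^-1 * (1 - e / 8) * (2 * (1 + e / 2) * u)
    <= 2^-1 * (1 - e / 8) * (parallel_sum a b * D ^+ 2).
  by rewrite ler_wpM2l//; lra.
have h4 : e ^+ 2 * u <= e * u by rewrite ler_pM2r//; nra.
have h5 : 0 < e * u by rewrite mulr_gt0.
move: h2 h3; move: (A / _) (_ * (parallel_sum a b * D ^+ 2)) => r z; lra.
Qed.

(** A pull happens either below the threshold, and then the count stays below
    the threshold plus one, or above it, and then it is counted by the sum. *)
Lemma count_le_threshold (K : nat) (x : nat -> 'I_K) (j : 'I_K) (th : nat -> R) :
  (forall s t, (s <= t)%N -> th s <= th t) -> 0 <= th 0%N ->
  forall t, (\sum_(s < t) (x s == j))%N%:R <= th t + 1 +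
    \sum_(s < t) (x s == j)%:R * (th s <= (\sum_(i < s) (x i == j))%N%:R)%R%:R.
Proof.
move=> th_mono th0; elim=> [|t IH]; first by rewrite !big_ord0 addr0 addr_ge0.
rewrite !big_ord_recr /= natrD.
have S0 : 0 <= \sum_(s < t) (x s == j)%:R * (th s <= (\sum_(i < s) (x i == j))%N%:R)%R%:R :> R.
  by apply: sumr_ge0 => s _; rewrite mulr_ge0.
have := th_mono t t.+1 (leqnSn t).
move: IH S0; move: (\sum_(s < t) (x s == j)%:R * _) => S IH S0 thS.
case: eqP => _ /=; last by rewrite mul0r; lra.
by rewrite mul1r; case: (leP (th t)) => H /=; move: IH thS H; lra.
Qed.

End pathwise.

(** * Pull counts along a trajectory *)

Section pathwise_pulls.
Context {R : realType} {K : nat}.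
Variables (mu : 'I_K -> R) (jstar : 'I_K) (Theta : set ('I_K -> R)).
Hypothesis best : forall j, j != jstar -> mu j < mu jstar.
Hypothesis mu_Theta : Theta mu.
Variables (x : nat -> 'I_K) (y : nat -> R).

Let data t : seq ('I_K * R) := [seq (x i, y i) | i <- iota 0 t].
Let count k t : nat := \sum_(s < t) (x s == k).
Let post t := posterior uniform_prior 1 Theta (data t).

Hypothesis dev_bound : forall k, exists M, forall t,
  arm_dev mu (data t) k ^+ 4 <= M * quartic_scale (count k t).+1.

Let countE k t : arm_count (data t) k = (count k t)%:R.
Proof.
by rewrite /arm_count /count /data big_map -[t in iota _ t]subn0 big_mkord natr_sum.
Qed.

Let count_le k t : (count k t <= t)%N.
Proof.
rewrite -[leqRHS]card_ord -sum1_card; apply: leq_sum => s _; exact: leq_b1.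
Qed.

Let data_neq0 t : (0 < t)%N -> data t != [::].
Proof. by case: t. Qed.

Let mu_optimal : optimal_params Theta jstar mu.
Proof.
split => // k; have [->//|/best/ltW//] := eqVneq k jstar.
Qed.

Let K_gt0 : (0 < K)%N. Proof. exact: leq_ltn_trans (ltn_ord jstar). Qed.

(** The misfit is o(ln t), because each of its finitely many terms is. *)
Let misfit_small e : 0 < e -> exists T, forall t, (T <= t)%N ->
  misfit mu (data t) <= e * ln (t%:R : R).
Proof.
move=> e0.
have KR : 0 < K%:R :> R by rewrite ltr0n.
pose e' := e / K%:R; have e0' : 0 < e' by rewrite divr_gt0.
have /choice[T HT] : forall k, exists T, forall t, (T <= t)%N ->
    arm_dev mu (data t) k ^+ 2 / (count k t)%:R <= e' * ln (t%:R : R).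
  by move=> k; have [M HM] := dev_bound k; exact: dev_sq_small HM (count_le k) e' e0'.
exists (maxn 1 (\max_k T k)) => t; rewrite geq_max => /andP[t0 Tt].
have u0 : 0 <= ln (t%:R : R) by rewrite ln_ge0// ler1n.
have : \sum_k arm_dev mu (data t) k ^+ 2 / arm_count (data t) k <= e * ln (t%:R : R).
  have -> : e * ln (t%:R : R) = \sum_(k < K) e' * ln (t%:R : R).
    by rewrite sumr_const card_ord -mulrnAl /e' -[X in _ = X * _]mulr_natr divfK// gt_eqF.
  apply: ler_sum => k _; rewrite countE; apply: HT.
  by apply: leq_trans Tt; exact: leq_bigmax.
move=> H; have : 0 <= e * ln (t%:R : R) by rewrite mulr_ge0// ltW.
rewrite /misfit; lra.
Qed.

Hypothesis best_sampled : exists M, forall t,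
  - (count jstar t)%:R <= (expR (- 1) - 1) * (\sum_(s < t) post s jstar) + M.

(** The sampling probability of the best arm is at least of order
    exp (- ln t / 2). *)
Let best_superlog C : exists T, forall t, (T <= t)%N -> C * ln t%:R <= (count jstar t)%:R :> R.
Proof.
have [M HM] := best_sampled.
apply: (@compensator_superlog R (fun s => post s jstar) (fun t => (count jstar t)%:R)
  K%:R^-1 (1 - expR (- 1)) M).
- by rewrite invr_gt0 ltr0n.
- by rewrite subr_gt0 -[ltRHS]expR0 ltr_expR ltrN10.
- by move=> t; have /andP[] := posterior_bounds Theta (data t) jstar.
- have h0 : 0 < 2^-1 :> R by rewrite invr_gt0.
  have [T HT] := misfit_small 2^-1 h0.
  exists (maxn 1 T) => t; rewrite geq_max => /andP[t0 Tt].
  apply: le_trans (posterior_optimal_ge Theta mu _ _ (data_neq0 t t0) mu_optimal).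
  by rewrite mulrC ler_pM2r ?invr_gt0 ?ltr0n// ler_expR lerN2 HT.
- by move=> t; have := HM t; lra.
Qed.

Variables (j : 'I_K) (e : R).
Hypothesis wrong : j != jstar.
Hypothesis e01 : 0 < e <= 1.

Let gapj := mu jstar - mu j.
Let threshold t : R := (1 + e) * (2 / gapj ^+ 2) * ln t%:R.
Let over t : R := (threshold t <= (count j t)%:R)%R%:R.

Hypothesis wrong_sampled : exists M, forall t,
  \sum_(s < t) (x s == j)%:R * over s
    <= (expR 1 - 1) * (\sum_(s < t) post s j * over s) + M.

(** Above the threshold the sampling probability of j is summable, so that
    only boundedly many pulls occur there. *)
Lemma pathwise_pulls : exists M, forall t,
  (count j t)%:R <= (1 + e) * (2 / gapj ^+ 2) * ln t%:R + M.
Proof.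
have gap0 : 0 < gapj by rewrite subr_gt0; exact: best.
have /andP[e0 e1] := e01.
have post01 t : 0 <= post t j <= 1 := posterior_bounds Theta (data t) j.
have [C [C0 HC]] := wrong_arm_exponent e gapj e01 gap0.
have [T1 HT1] := best_superlog C.
have d0 : 0 < e ^+ 2 / 64 by rewrite divr_gt0// exprn_gt0.
have [T2 HT2] := misfit_small _ d0.
have [M HM] := wrong_sampled.
have [B HB] : exists B, forall t, \sum_(s < t) post s j * over s <= B.
  apply: (sum_le_of_decay (fun s => post s j * over s) (e / 8)); first by rewrite divr_gt0.
    move=> t; have /andP[p0 p1] := post01 t; rewrite /over.
    by case: (threshold t <= _); rewrite ?mulr1 ?mulr0 ?p0 ?lexx ?ler01.
  exists (maxn 2 (maxn T1 T2)) => t; rewrite !geq_max => /and3P[t2 tT1 tT2].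
  rewrite /over; case: (leP (threshold t) (count j t)%:R) => [over_t|_]; last first.
    by rewrite mulr0 expR_ge0.
  rewrite mulr1.
  have u0 : 0 < ln (t%:R : R) by rewrite ln_gt0// ltr1n.
  have eta01 : 0 < e / 8 < 1 by apply/andP; split; lra.
  apply: le_trans
    (posterior_wrong_le Theta mu (data t) jstar j (e / 8) _ eta01 mu_optimal _) _.
  - exact: data_neq0 (ltnW t2).
  - by rewrite eq_sym.
  rewrite ler_expR !countE; apply: HC => //.
  - exact: HT1.
  - exact: HT2.
have th_mono s t : (s <= t)%N -> threshold s <= threshold t.
  move=> st; rewrite ler_wpM2l//.
    by rewrite mulr_ge0 ?divr_ge0 ?sqr_ge0//; lra.
  case: s st => [|s] st.
    rewrite [leLHS]ln0//; case: t {st} => [|t]; first by rewrite ln0.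
    by rewrite ln_ge0// ler1n.
  by rewrite ler_ln ?posrE ?ltr0n ?ler_nat// (leq_trans _ st).
have th0 : 0 <= threshold 0 by rewrite /threshold ln0// mulr0.
exists (1 + (expR 1 - 1) * B + M) => t.
have := count_le_threshold K x j threshold th_mono th0 t.
have := HM t; have : 0 <= expR 1 - 1 :> R by rewrite subr_ge0 -[leLHS]expR0 ler_expR.
move=> /ler_wpM2l /(_ _ _ (HB t)).
rewrite -/(count j t) /over -/(threshold t).
lra.
Qed.

End pathwise_pulls.

(** * Regret *)

Lemma ae_forall_ord {d} {Omega : measurableType d} {R : realType} (P : probability Omega R)
    (K : nat) (Q : 'I_K -> Omega -> Prop) :
  (forall k, {ae P, forall w, Q k w}) -> {ae P, forall w, forall k, Q k w}.
Proof.
move=> H; have : {ae P, forall w, forall n (k : 'I_K), k = n :> nat -> Q k w}.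
  apply: ae_foralln => n; have [nK|Kn] := ltnP n K.
    apply: filterS (H (Ordinal nK)) => w Qw k kn.
    by rewrite (_ : k = Ordinal nK)//; exact: val_inj.
  by apply: nearW => w k kn; have := ltn_ord k; rewrite kn ltnNge Kn.
by apply: filterS => w Hw k; exact: Hw.
Qed.

Section dataset_statistics.
Context {d : measure_display} {Omega : measurableType d} {R : realType} {K : nat}.
Variables (X : nat -> Omega -> 'I_K) (Y : nat -> Omega -> R).

Lemma arm_dev_dataset (mu : 'I_K -> R) k t w :
  arm_dev mu (dataset X Y t w) k = deviation X Y k (mu k) t w.
Proof.
rewrite /arm_dev /deviation /dataset big_map -[t in iota _ t]subn0 big_mkord.
by apply: eq_bigr => s _ /=; case: eqP => _; rewrite ?mul1r ?mul0r.
Qed.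

End dataset_statistics.

Section gap_and_regret.
Context {R : realType} {K : nat} (mu : 'I_K -> R) (jstar : 'I_K).
Hypothesis best : forall j, j != jstar -> mu j < mu jstar.

Lemma gapE j : gap mu j = mu jstar - mu j.
Proof.
have mu_le k : mu k <= mu jstar by have [->//|/best/ltW] := eqVneq k jstar.
rewrite /gap; congr (_ - _); apply/eqP; rewrite eq_le; apply/andP; split.
  by apply: bigmax_le.
exact: le_bigmax.
Qed.

Lemma regret_pulls {d} {Omega : measurableType d} (X : nat -> Omega -> 'I_K) T w :
  regret mu X T w = \sum_(j < K | j != jstar) gap mu j * (\sum_(s < T) (X s w == j))%N%:R.
Proof.
rewrite /regret.
under [RHS]eq_bigr do rewrite natr_sum mulr_sumr.
rewrite exchange_big /=; apply: eq_bigr => t _.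
have [->|Xt] := eqVneq (X t w) jstar.
  rewrite gapE subrr big1// => j /negbTE; rewrite eq_sym => ->; exact: mulr0.
rewrite (bigD1 (X t w))//= eqxx mulr1 big1 ?addr0// => j /andP[_ /negbTE].
by rewrite eq_sym => ->; exact: mulr0.
Qed.

End gap_and_regret.

Lemma limn_esup_le_eventually {R : realType} (r : nat -> R) (S : R) :
  (forall e, 0 < e -> exists T, forall t, (T <= t)%N -> r t <= S + e) ->
  (limn_esup (fun t => (r t)%:E) <= S%:E)%E.
Proof.
move=> H; apply/lee_addgt0Pr => e /H[T HT].
apply: (@le_trans _ _ (ereal_sup [set (r t)%:E | t in [set t | (T <= t)%N]])).
  by apply: ereal_inf_lbound; exists [set t | (T <= t)%N] => //; exists T.
by apply: ge_ereal_sup => _ [t /HT rt <-]; rewrite -EFinD lee_fin.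
Qed.

(** After division by ln t the constants M become negligible for each fixed n,
    and then the factor 1 + 1/(n+1) is sent to 1. *)
Lemma regret_rate {R : realType} {K : nat} (mu : 'I_K -> R) (jstar : 'I_K)
    (x : nat -> 'I_K) :
  (forall j, j != jstar -> mu j < mu jstar) ->
  (forall n j, j != jstar -> exists M, forall t,
    (\sum_(s < t) (x s == j))%N%:R <=
      (1 + n.+1%:R^-1) * (2 / (mu jstar - mu j) ^+ 2) * ln (t%:R : R) + M) ->
  forall e, 0 < e -> exists T, forall t, (T <= t)%N ->
    (\sum_(j < K | j != jstar) gap mu j * (\sum_(s < t) (x s == j))%N%:R) / ln t%:R
      <= \sum_(j < K | j != jstar) 2 / gap mu j + e.
Proof.
move=> best H e e0.
have gap0 j : j != jstar -> 0 < gap mu j by rewrite (gapE mu jstar best) subr_gt0; exact: best.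
set S := \sum_(j < K | j != jstar) 2 / gap mu j.
have S0 : 0 <= S by apply: sumr_ge0 => j /gap0 g0; rewrite divr_ge0// ltW.
pose n := Num.truncn (2 * S / e).
have nS : n.+1%:R^-1 * S <= e / 2.
  rewrite ler_pdivrMl ?ltr0n//.
  have := truncnS_gt (2 * S / e); rewrite -/n ltr_pdivrMr//; lra.
have /choice[M HM] : forall j : 'I_K, exists M, j != jstar -> forall t,
    (\sum_(s < t) (x s == j))%N%:R <=
      (1 + n.+1%:R^-1) * (2 / (mu jstar - mu j) ^+ 2) * ln (t%:R : R) + M.
  move=> j; have [_|/(H n j)[M HM]] := eqVneq j jstar; first by exists 0.
  by exists M => _.
pose B := \sum_(j < K | j != jstar) gap mu j * M j.
have [T HT] := ln_eventually_ge (Num.max 1 (2 * B / e)).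
exists T => t /HT; rewrite ge_max => /andP[u1]; rewrite ler_pdivrMr// => uB.
have u0 : 0 < ln (t%:R : R) by exact: lt_le_trans u1.
rewrite ler_pdivrMr//.
apply: (@le_trans _ _ ((1 + n.+1%:R^-1) * S * ln t%:R + B)).
  rewrite [_ * S]mulr_sumr mulr_suml -big_split /=; apply: ler_sum => j jj.
  have g0 := gap0 j jj.
  apply: le_trans (ler_wpM2l (ltW g0) (HM j jj t)) _.
  rewrite -(gapE mu jstar best); move: (n.+1%:R^-1) => i.
  rewrite le_eqVlt; apply/orP; left; apply/eqP; field.
  by rewrite gt_eqF.
have combine (i s u b : R) : i * s * u <= e / 2 * u -> 2 * b <= u * e ->
    (1 + i) * s * u + b <= (s + e) * u by lra.
by apply: combine => //; exact: ler_wpM2r (ltW u0) _ _ nS.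
Qed.

Theorem theorem4p3 (R : realType) (K : nat)
    (nu : 'I_K -> probability (measurableTypeR R) R)
    (mu : 'I_K -> R)
    (mean_nu : forall j, ('E_(nu j)[fun y => y] = (mu j)%:E)%E)
    (var_nu : forall j, ('V_(nu j)[fun y => y] < +oo)%E)
    (jstar : 'I_K)
    (best : forall j, j != jstar -> mu j < mu jstar)
    (Theta : set ('I_K -> R)) (mu_Theta : Theta mu)
    (d : measure_display) (Omega : measurableType d) (P : probability Omega R)
    (X : nat -> Omega -> 'I_K) (Y : nat -> {RV P >-> R})
    (X_measurable : forall t j, measurable (X t @^-1` [set j]))
    (feedback_law : bandit_feedback P nu X Y)
    (mints : samples_from P (posterior uniform_prior 1 Theta) X Y) :
  {ae P, forall w,
    (limn_esup (fun T : nat => (regret mu X T w / ln T%:R)%:E)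
      <= (\sum_(j < K | j != jstar) 2 / gap mu j)%:E)%E}.
Proof.
have mY t : measurable_fun setT (Y t) by [].
pose post j t w := posterior uniform_prior 1 Theta (dataset X Y t w) j.
have mpost j t : measurable_fun [set: g_sigma_algebraType (data_events X Y t)] (post j t).
  apply/measurable_EFinP => _ B mB; rewrite setTI.
  by have [H _ _] := mints t j; exact: H.
have post01 j t w : 0 <= post j t w <= 1 := posterior_bounds Theta _ j.
have postE j t C : <<s data_events X Y t >> C ->
    (\int[P]_(w in C) (post j t w)%:E = P (X t @^-1` [set j] `&` C))%E.
  by have [_ _ H] := mints t j; exact: H.
have XE j t : <<s data_events X Y t.+1 >> (X t @^-1` [set j]).
  exact: data_arm_sub_data (data_arm_event X Y t j).
have indE j t w : \1_(X t @^-1` [set j]) w = (X t w == j)%:R :> R.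
  by rewrite indicE; congr (nat_of_bool _)%:R; apply/idP/idP; rewrite inE => /eqP.
pose th n j t : R := (1 + n.+1%:R^-1) * (2 / (mu jstar - mu j) ^+ 2) * ln t%:R.
pose E n j t := [set w | th n j t <= (pulls X j t w)%:R].
have GE n j t : <<s data_events X Y t >> (E n j t).
  have := measurable_pulls X Y j t t (leqnn t) measurableT
    [set i : nat | th n j t <= i%:R] Logic.I.
  by rewrite setTI.
have compensated j F (GF : forall t, <<s data_events X Y t >> (F t)) l :=
  count_le_compensator P (fun t => data_events X Y t) (data_increasing X Y)
  (data_measurable X Y X_measurable mY) (fun t => X t @^-1` [set j]) F (post j)
  (XE j) GF (mpost j) (post01 j) (postE j) l.
have dev : {ae P, forall w, forall k, exists M, forall t,
    arm_dev mu (dataset X Y t w) k ^+ 4 <= M * quartic_scale (pulls X k t w).+1}.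
  apply: ae_forall_ord => k.
  apply: filterS (deviation_bound P X Y X_measurable mY nu feedback_law k (mu k)
    (mean_nu k) (var_nu k)) => w [M HM].
  by exists M => t; rewrite arm_dev_dataset.
have star := compensated jstar (fun=> setT)
  (fun t => @measurableT _ (g_sigma_algebraType (data_events X Y t))) (- 1).
have wrong : {ae P, forall w, forall n j, exists M, forall t,
    1 * event_count (fun t => X t @^-1` [set j]) (E n j) t w
      <= (expR 1 - 1) * compensator (E n j) (post j) t w + M}.
  apply: ae_foralln => n; apply: ae_forall_ord => j.
  exact: compensated.
move: dev star wrong; apply: filterS3 => w dev [M0 star] wrong.
apply: limn_esup_le_eventually => e e0.
have [T HT] : exists T, forall t, (T <= t)%N ->
    (\sum_(j < K | j != jstar) gap mu j * (\sum_(s < t) (X s w == j))%N%:R) / ln t%:R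
      <= \sum_(j < K | j != jstar) 2 / gap mu j + e; last first.
  by exists T => t /HT; rewrite (regret_pulls mu jstar best).
apply: (regret_rate mu jstar (fun s => X s w)) => // n j jj.
apply: (pathwise_pulls mu jstar Theta best mu_Theta (fun s => X s w) (fun s => Y s w)) => //.
- exists M0 => t; have := star t; rewrite /event_count /compensator.
  under eq_bigr do rewrite indE indicT mulr1.
  under [in X in _ <= X -> _]eq_bigr do rewrite indicT mulr1.
  by rewrite mulN1r natr_sum.
- by rewrite invr_gt0 ltr0n invf_le1 ?ltr0n// ler1n.
- have [M HM] := wrong n j; exists M => t; have := HM t.
  rewrite mul1r /event_count /compensator.
  have inE_ s : \1_(E n j s) w = (th n j s <= (pulls X j s w)%:R)%R%:R :> R.
    by rewrite indicE; congr (nat_of_bool _)%:R; apply/idP/idP; rewrite inE.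
  under eq_bigr do rewrite indE inE_.
  by under [in X in _ <= X -> _]eq_bigr do rewrite inE_.
Qed.
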